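(* Let $\Gamma$ be a finite group acting by isometries on a compact smooth Riemannian manifold $M$ with $M/\Gamma$ connected, and let $E,F\to M$ be $\Gamma$-equivariant vector bundles. Assume that $\Gamma$ acts freely on a dense subset of $M$, and let $P\in\psi^m(M;E,F)^\Gamma$ be a $\Gamma$-invariant classical pseudodifferential operator of order $m\in\mathbb{R}$. Then, for any $\alpha\in\widehat{\Gamma}$, $P$ is $\alpha$-elliptic if, and only if, $P$ is elliptic.
   Context: $\widehat{K}$ is the set of isomorphism classes of irreducible complex representations of a finite group $K$. $\Gamma_x$, $\Gamma_\xi$ are the isotropy groups of $x\in M$, $\xi\in T^*M$. $P$ is elliptic if its principal symbol $\sigma_m(P)\in\mathcal{C}^\infty(T^*M\smallsetminus\{0\};\mathrm{Hom}(E,F))^\Gamma$ is invertible everywhere on $T^*M\smallsetminus\{0\}$. For $\xi\in T^*_xM\smallsetminus\{0\}$ and $\rho\in\widehat{\Gamma}_\xi$, $\pi_\rho(\sigma_m(P)(\xi)):E_{x\rho}\to F_{x\rho}$ denotes the restriction of $\sigma_m(P)(\xi)$ to the $\rho$-isotypical components of the $\Gamma_\xi$-modules $E_x,F_x$. For $g\in\Gamma$, $g\cdot\rho\in\widehat{\Gamma}_{g\xi}$ is $(g\cdot\rho)(h)=\rho(g^{-1}hg)$. Let $\Gamma_0$ be a minimal element (for inclusion) among the isotropy groups of points of $M$ (unique up to conjugacy as $M/\Gamma$ is connected), and let $X^\alpha_{M,\Gamma}$ be the set of pairs $(\xi,\rho)$, $\xi\in T^*M\smallsetminus\{0\}$,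 $\rho\in\widehat{\Gamma}_\xi$, such that there is $g\in\Gamma$ with $\Gamma_0\subset\Gamma_{g\xi}$ and $\mathrm{Hom}_{\Gamma_0}(g\cdot\rho,\alpha)\neq0$. $P$ is $\alpha$-elliptic if $\pi_\rho(\sigma_m(P)(\xi))$ is invertible for all $(\xi,\rho)\in X^\alpha_{M,\Gamma}$ (a map $0\to0$ being regarded as invertible). *)

(* Defs.v *)
From HB Require Import structures.
From mathcomp Require Import all_boot all_order all_algebra all_fingroup.
From mathcomp Require Import generic_quotient mxrepresentation.
From mathcomp Require Import all_classical all_reals all_analysis.
From mathcomp Require Import complex.

Set Implicit Arguments.
Unset Strict Implicit.
Unset Printing Implicit Defensive.

Import Order.TTheory GRing.Theory Num.Theory.
Import numFieldNormedType.Exports.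
Local Open Scope classical_set_scope.
Local Open Scope ring_scope.
Local Open Scope complex_scope.
Local Open Scope quotient_scope.

Section Smoothness.
Context {R : realType}.

Fixpoint iter_derive {V W : normedModType R} (l : seq V) (f : V -> W) : V -> W :=
  if l is v :: l' then 'D_v (iter_derive l' f) else f.

(* C^oo on an open set D: all iterated directional derivatives exist there and
   are themselves (Frechet) differentiable, hence continuous. *)
Definition smooth_on {V W : normedModType R} (D : set V) (f : V -> W) : Prop :=
  forall (l : seq V) (x : V), D x -> differentiable (iter_derive l f) x.

Definition csmooth_on {V : normedModType R} (D : set V) (f : V -> R[i]) : Prop :=
  smooth_on D (fun x => complex.Re (f x)) /\
  smooth_on D (fun x => complex.Im (f x)).

End Smoothness.

Section Manifold.
Context {R : realType} {n : nat} {M : topologicalType}.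

(* [chart_map] and [chart_inv] are total; they are only meaningful on
   [chart_dom] and on its image [chart_im]. *)
Record chart := Chart {
  chart_dom : set M;
  chart_map :> M -> 'rV[R]_n;
  chart_inv : 'rV[R]_n -> M;
  chart_dom_open : open chart_dom;
  chart_im_open : open (chart_map @` chart_dom);
  chart_mapK : forall x, chart_dom x -> chart_inv (chart_map x) = x;
  chart_map_cont : forall x, chart_dom x -> {for x, continuous chart_map};
  chart_inv_cont : forall y, (chart_map @` chart_dom) y ->
    {for y, continuous chart_inv} }.

Definition chart_im (c : chart) : set 'rV[R]_n := c @` chart_dom c.

Definition chart_compat (c d : chart) : Prop :=
  smooth_on (c @` (chart_dom c `&` chart_dom d)) (d \o chart_inv c).

(* An atlas indexed by points, with a preferred chart around each point; every
   atlas can be presented in this way.  The smooth structure it defines is the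
   maximal atlas [is_chart]. *)
Record atlas := Atlas {
  chart_at : M -> chart;
  chart_at_mem : forall x, chart_dom (chart_at x) x;
  chart_at_compat : forall x y, chart_compat (chart_at x) (chart_at y) }.

Variable X : atlas.

Definition is_chart (c : chart) : Prop :=
  forall x, chart_compat c (chart_at X x) /\ chart_compat (chart_at X x) c.

Definition smooth_fun (U : set M) (f : M -> R) : Prop :=
  forall x, smooth_on (chart_at X x @` (chart_dom (chart_at X x) `&` U))
                      (f \o chart_inv (chart_at X x)).

Definition csmooth_fun (U : set M) (f : M -> R[i]) : Prop :=
  smooth_fun U (fun x => complex.Re (f x)) /\
  smooth_fun U (fun x => complex.Im (f x)).

Definition chart_expr (f : M -> M) (x y : M) : 'rV[R]_n -> 'rV[R]_n :=
  chart_at X y \o f \o chart_inv (chart_at X x).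

Definition smooth_map (f : M -> M) : Prop :=
  continuous f /\
  forall x y, smooth_on
    (chart_at X x @` (chart_dom (chart_at X x) `&` f @^-1` chart_dom (chart_at X y)))
    (chart_expr f x y).

(* The tangent space T_xM is identified with 'rV[R]_n by the preferred chart at
   x, and T*_xM with 'rV[R]_n by the dual coordinates: the value of the covector
   xi on the vector v is v *m xi^T.  Jacobian matrices act on row vectors on the
   right, so d_x f : T_xM -> T_(f x)M is v |-> v *m tangent f x. *)
Definition tangent (f : M -> M) (x : M) : 'M[R]_n :=
  'J (chart_expr f x (f x)) (chart_at X x x).

Definition tangent_chart (c : chart) (x : M) : 'M[R]_n :=
  'J (c \o chart_inv (chart_at X x)) (chart_at X x x).

(* The covector at x whose coordinates in the chart c are eta. *)
Definition covector (c : chart) (x : M) (eta : 'rV[R]_n) : 'rV[R]_n :=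
  eta *m (tangent_chart c x)^T.

Definition cotangent : Type := (M * 'rV[R]_n)%type.

Record riemannian_metric := RiemannianMetric {
  metric :> M -> 'M[R]_n;
  metric_sym : forall x, (metric x)^T = metric x;
  metric_pos : forall x (v : 'rV[R]_n), v != 0 ->
    0 < (v *m metric x *m v^T) 0 0;
  metric_smooth : forall z i j, smooth_fun (chart_dom (chart_at X z))
    (fun x => let D := invmx (tangent_chart (chart_at X z) x) in
              (D *m metric x *m D^T) i j) }.

Definition riemannian_isometry (G : riemannian_metric) (f : M -> M) : Prop :=
  forall x, tangent f x *m G (f x) *m (tangent f x)^T = G x.

Lemma chart_inv_nbhs (c : chart) (x : M) (U : set M) :
  chart_dom c x -> nbhs x U -> \forall p \near c x, U (chart_inv c p).
Proof.
move=> cx xU; have := @chart_inv_cont c (c x) (imageP c cx).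
by rewrite /prop_for /continuous_at chart_mapK //; apply.
Qed.

Lemma jacobian_rowE (f : 'rV[R]_n -> 'rV[R]_n) p i :
  differentiable f p -> row i ('J f p) = 'D_(delta_mx 0 i) f p.
Proof. by move=> df; rewrite rowE (deriveEjacobian _ df). Qed.

Lemma chart_expr_diff (f : M -> M) (x : M) : smooth_map f ->
  differentiable (chart_expr f x (f x)) (chart_at X x x).
Proof.
move=> [_ fs]; apply: (fs x (f x) [::] (chart_at X x x)).
by exists x; split; exact: chart_at_mem.
Qed.

Lemma tangent_comp (f g : M -> M) : smooth_map f -> smooth_map g ->
  smooth_map (g \o f) ->
  forall x, tangent (g \o f) x = tangent f x *m tangent g (f x).
Proof.
move=> sf sg sh x.
have memx := @chart_at_mem X.
have df := chart_expr_diff x sf.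
have dg := chart_expr_diff (f x) sg.
have dh := chart_expr_diff x sh.
have fx : chart_expr f x (f x) (chart_at X x x) = chart_at X (f x) (f x).
  by rewrite /chart_expr /= (chart_mapK (memx x)).
rewrite -fx in dg.
have dgf := differentiable_comp df dg.
have nr : \forall p \near chart_at X x x,
    chart_expr (g \o f) x (g (f x)) p =
    (chart_expr g (f x) (g (f x)) \o chart_expr f x (f x)) p.
  have : nbhs x (f @^-1` chart_dom (chart_at X (f x))).
    apply: sf.1; apply: open_nbhs_nbhs; split; last exact: memx.
    exact: chart_dom_open.
  move=> /(chart_inv_nbhs (memx x)); apply: filterS => p fp.
  by rewrite /chart_expr /= (chart_mapK fp).
apply/row_matrixP => i; rewrite row_mul.
apply: (etrans (jacobian_rowE i dh)).
apply: etrans (congr1 (mulmxr (tangent g (f x))) (esym (jacobian_rowE i df))).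
rewrite /mulmxr /tangent.
have E := deriveEjacobian ('D_(delta_mx 0 i) (chart_expr f x (f x)) (chart_at X x x)) dg.
rewrite fx in E; apply: etrans E.
apply: (etrans (near_eq_derive _ nr)).
rewrite (deriveE _ dgf) (diff_comp df dg) -fx.
by rewrite (deriveE _ dg) (deriveE _ df).
Qed.

End Manifold.
Arguments chart : clear implicits.
Arguments atlas : clear implicits.
Arguments cotangent : clear implicits.

Section Action.
Context {R : realType} {n : nat} {M : topologicalType} {X : atlas R n M}.
Context {gT : finGroupType}.

Lemma tangent_id (x : M) : tangent X id x = 1%:M.
Proof.
have memx := @chart_at_mem _ _ _ X.
have nr : \forall p \near chart_at X x x, chart_expr X id x x p = id p.
  have nim : nbhs (chart_at X x x) (chart_im (chart_at X x)).
    by apply: open_nbhs_nbhs; split; [exact: chart_im_open|exists x].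
  by apply: filterS nim => _ [y yx <-]; rewrite /chart_expr /= chart_mapK.
have sid : differentiable (chart_expr X id x x) (chart_at X x x).
  apply: (@chart_at_compat _ _ _ X x x [::] (chart_at X x x)).
  by exists x; split; exact: memx.
apply/row_matrixP => i; apply: (etrans (jacobian_rowE i sid)).
apply: (etrans (near_eq_derive _ nr)).
by rewrite derive_id rowE mulmx1.
Qed.

Record smooth_action := SmoothAction {
  act_on :> gT -> M -> M;
  act_on1 : forall x, act_on 1%g x = x;
  act_onM : forall g h x, act_on (g * h)%g x = act_on g (act_on h x);
  act_smooth : forall g, smooth_map X (act_on g) }.

Variable a : smooth_action.

Lemma act_onK g x : a g^-1%g (a g x) = x.
Proof. by rewrite -act_onM mulVg act_on1. Qed.

Lemma act_onKV g x : a g (a g^-1%g x) = x.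
Proof. by rewrite -act_onM mulgV act_on1. Qed.

(* g xi = xi o d(g^-1) *)
Definition cact (g : gT) (p : cotangent R n M) : cotangent R n M :=
  (a g p.1, p.2 *m (tangent X (a g^-1%g) (a g p.1))^T).

Lemma cact1 p : cact 1%g p = p.
Proof.
case: p => x xi; rewrite /cact /= invg1.
have -> : a 1%g = id by apply/funext => y; exact: act_on1.
by rewrite tangent_id trmx1 mulmx1.
Qed.

Lemma cactM g h p : cact (g * h)%g p = cact g (cact h p).
Proof.
case: p => x xi.
have E : a (g * h)^-1%g = a h^-1%g \o a g^-1%g.
  by rewrite invMg; apply/funext => y; exact: act_onM.
have S := act_smooth a (g * h)^-1%g; rewrite E in S.
have T := tangent_comp (act_smooth a _) (act_smooth a _) S (a g (a h x)).
rewrite act_onK -E in T.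
have E2 (v : 'rV[R]_n) (A B : 'M[R]_n) : v *m A^T *m B^T = v *m (B *m A)^T.
  by rewrite trmx_mul mulmxA.
rewrite /cact; apply: (congr2 pair (act_onM a g h x)).
apply: etrans (esym (E2 _ _ _)).
rewrite (act_onM a g h x).
exact: (congr1 (fun A : 'M[R]_n => xi *m A^T) T).
Qed.

Definition stab (x : M) : {set gT} := finset (fun g => a g x == x).

Lemma stab_group_set x : group_set (stab x).
Proof.
apply/group_setP; split; first by rewrite inE act_on1.
by move=> g h; rewrite !inE act_onM => /eqP gx /eqP ->; rewrite gx.
Qed.
Canonical stab_group x := Group (stab_group_set x).

Definition cstab (p : cotangent R n M) : {set gT} :=
  finset (fun g => cact g p == p).

Lemma cstab_group_set p : group_set (cstab p).
Proof.
apply/group_setP; split; first by rewrite inE cact1.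
by move=> g h; rewrite !inE cactM => /eqP gx /eqP ->; rewrite gx.
Qed.
Canonical cstab_group p := Group (cstab_group_set p).

Definition same_orbit : rel M := fun x y => `[< exists g, y = a g x >].

Lemma same_orbit_class : equiv_class_of same_orbit.
Proof.
have S x y : same_orbit x y -> same_orbit y x.
  by move=> /asboolP[g ->]; apply/asboolP; exists g^-1%g; rewrite act_onK.
split.
- by move=> x; apply/asboolP; exists 1%g; rewrite act_on1.
- by move=> x y; apply/idP/idP; exact: S.
- move=> y x z /asboolP[g ->] /asboolP[h ->].
  by apply/asboolP; exists (h * g)%g; rewrite act_onM.
Qed.
Canonical orbit_equiv := EquivRelPack same_orbit_class.

Definition orbit_space : topologicalType :=
  quotient_topology {eq_quot orbit_equiv}.

Definition minimal_isotropy (G0 : {group gT}) : Prop :=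
  (exists x, G0 = stab_group x) /\
  forall x, stab x \subset G0 -> stab x = G0.

Definition free_on_dense : Prop :=
  exists D : set M, dense D /\ forall x g, D x -> a g x = x -> g = 1%g.

End Action.
Arguments smooth_action {R n M} X gT.

Section Bundle.
Context {R : realType} {n : nat} {M : topologicalType} {X : atlas R n M}.

Record frame (E : M -> vectType R[i]) := Frame {
  frame_dom : set M;
  frame_rank : nat;
  frame_vec :> forall x, frame_rank.-tuple (E x);
  frame_dom_open : open frame_dom;
  frame_basis : forall x, frame_dom x -> basis_of fullv (frame_vec x) }.

Definition frame_compat (E : M -> vectType R[i]) (e f : frame E) : Prop :=
  forall j k, csmooth_fun X (frame_dom e `&` frame_dom f)
    (fun x => coord (f x) k (tnth (e x) j)).

Record bundle := Bundle {
  fiber :> M -> vectType R[i];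
  frame_at : M -> frame fiber;
  frame_at_mem : forall x, frame_dom (frame_at x) x;
  frame_at_compat : forall x y, frame_compat (frame_at x) (frame_at y) }.

Definition is_frame (E : bundle) (e : frame E) : Prop :=
  forall x, frame_compat e (frame_at E x) /\ frame_compat (frame_at E x) e.

Definition section_of (E : bundle) : Type := forall x, E x.

Definition smooth_section (E : bundle) (s : section_of E) : Prop :=
  forall x k, csmooth_fun X (frame_dom (frame_at E x))
    (fun y => coord (frame_at E x y) k (s y)).

Context {gT : finGroupType}.

(* The linear maps g : E_x -> E_(g x); the target point is kept up to a proof of
   a g x = y, so that for g in the isotropy group of x the map is an
   endomorphism of E_x. *)
Record equivariant (a : smooth_action X gT) (E : bundle) := Equivariant {
  eact : forall (g : gT) (x y : M), a g x = y -> 'Hom(E x, E y);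
  eact1 : forall x (e : a 1%g x = x) v, eact e v = v;
  eactM : forall g h x y z (hx : a h x = y) (gy : a g y = z)
    (ghx : a (g * h)%g x = z) v, eact ghx v = eact gy (eact hx v);
  eact_smooth : forall g x y j k, csmooth_fun X
    (frame_dom (frame_at E x) `&` a g @^-1` frame_dom (frame_at E y))
    (fun z => coord (frame_at E y (a g z)) k
                (eact (erefl (a g z)) (tnth (frame_at E x z) j))) }.

Definition sact (a : smooth_action X gT) (E : bundle) (A : equivariant a E)
    (g : gT) (s : section_of E) : section_of E :=
  fun x => eact A (act_onKV a g x) (s (a g^-1%g x)).

End Bundle.
Arguments bundle {R n M} X.

Section Symbols.
Context {R : realType} {n : nat}.
Local Notation V := 'rV[R]_n.

Definition cis (t : R) : R[i] := cos t +i* sin t.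

Definition dotp (y xi : V) : R := (y *m xi^T) 0 0.

Definition plane_wave (xi : V) : V -> R[i] := fun y => cis (dotp y xi).

(* Lebesgue integral over R^d, as an iterated integral. *)
Fixpoint integral_rV (d : nat) : ('rV[R]_d -> R) -> R :=
  if d is d'.+1 then fun f =>
    \int[lebesgue_measure]_(t in [set: R])
      integral_rV (fun y : 'rV[R]_d' => f (row_mx (const_mx t : 'rV_1) y))
  else fun f => f 0.

Definition cintegral (f : V -> R[i]) : R[i] :=
  integral_rV (fun y => complex.Re (f y)) +i*
  integral_rV (fun y => complex.Im (f y)).

Definition fourier (u : V -> R[i]) (xi : V) : R[i] :=
  cintegral (fun y => cis (- dotp y xi) * u y).

Definition test_function (u : V -> R[i]) : Prop :=
  csmooth_on setT u /\ exists K, compact K /\ forall y, ~ K y -> u y = 0.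

(* d_y^vs d_xi^ws *)
Definition mixed_derive (vs ws : seq V) : (V * V -> R) -> V * V -> R :=
  iter_derive ([seq (v, 0) | v <- vs] ++ [seq (0, w) | w <- ws]).

Definition symbol_bound (D : set V) (mu : R) (b : V * V -> R) : Prop :=
  forall (K : set V) (vs ws : seq V), compact K -> K `<=` D ->
  exists c : R, forall y xi, K y -> 1 <= `|xi| ->
    `|mixed_derive vs ws b (y, xi)| <=
      c * (1 + `|xi|) `^ (mu - (size ws)%:R).

(* b is a classical symbol of order m on D x R^n, b ~ b_0 + b_1 + ... with b_j
   smooth for xi != 0 and homogeneous of degree m - j in xi; b0 is the leading
   term b_0.  The bounds are only needed for |xi| >= 1, which avoids cutting off
   the b_j near xi = 0. *)
Definition classical_symbol (D : set V) (m : R)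
    (b b0 : V * V -> R[i]) : Prop :=
  csmooth_on (D `*` setT) b /\
  exists bs : nat -> V * V -> R[i],
  [/\ forall y xi, D y -> xi != 0 -> bs 0%N (y, xi) = b0 (y, xi),
      forall j, csmooth_on (D `*` [set xi | xi != 0]) (bs j),
      forall j y xi (t : R), D y -> xi != 0 -> 0 < t ->
        bs j (y, t *: xi) = (t `^ (m - j%:R))%:C * bs j (y, xi) &
      forall N, symbol_bound D (m - N%:R)
                  (fun p => complex.Re (b p - \sum_(j < N) bs j p)) /\
                symbol_bound D (m - N%:R)
                  (fun p => complex.Im (b p - \sum_(j < N) bs j p))].

(* b(y, xi) = e^(-i y.xi) A(e^(i y.xi)), the full symbol of a properly supported
   operator A (Shubin, Definition 3.4). *)
Definition full_symbol (A : (V -> R[i]) -> V -> R[i]) (p : V * V) : R[i] :=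
  cis (- dotp p.1 p.2) * A (plane_wave p.2) p.1.

(* A = Op(b) on D: (A u)(y) = (2 pi)^-n \int e^(i y.xi) b(y, xi) u^(xi) dxi. *)
Definition is_quantization (D : set V) (A : (V -> R[i]) -> V -> R[i])
    (b : V * V -> R[i]) : Prop :=
  forall u y, test_function u -> D y ->
    A u y = ((2 * pi) ^- n)%:C *
            cintegral (fun xi => cis (dotp y xi) * b (y, xi) * fourier u xi).

End Symbols.

Section Pseudodifferential.
Context {R : realType} {n : nat} {M : topologicalType} {X : atlas R n M}.

Definition cutoff (c : chart R n M) (chi : M -> R) : Prop :=
  smooth_fun X setT chi /\ closure [set x | chi x != 0] `<=` chart_dom c.

Variables E F : bundle X.

Definition operator : Type := section_of E -> section_of F.

Record smooth_operator (P : operator) : Prop := SmoothOperator {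
  operator_smooth : forall s, smooth_section s -> smooth_section (P s);
  operator_linear : forall (k : R[i]) s t, smooth_section s ->
    smooth_section t ->
    forall x, P (fun y => k *: s y + t y) x = k *: P s x + P t x }.

(* The (k, j) entry of chi P psi read in the chart c and the frames e, f. *)
Definition localization (P : operator) (c : chart R n M) (e : frame E)
    (f : frame F) (chi psi : M -> R) (j : 'I_(frame_rank e))
    (k : 'I_(frame_rank f)) (u : 'rV[R]_n -> R[i]) (y : 'rV[R]_n) : R[i] :=
  let x := chart_inv c y in
  (chi x)%:C *
  coord (f x) k (P (fun z => ((psi z)%:C * u (c z)) *: tnth (e z) j) x).

Definition local_data (c : chart R n M) (e : frame E) (f : frame F)
    (chi psi : M -> R) : Prop :=
  [/\ is_chart X c, is_frame e /\ chart_dom c `<=` frame_dom e,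
      is_frame f /\ chart_dom c `<=` frame_dom f, cutoff c chi & cutoff c psi].

(* Classical pseudodifferential operators of order m: every chi P psi, in every
   chart, is the quantization of its full symbol and this symbol is classical of
   order m.  Charts of the maximal atlas need not be connected, and any two
   points lie in a common chart (for n > 0), so that smoothness of the kernel
   off the diagonal is included. *)
Definition pseudodifferential (m : R) (P : operator) : Prop :=
  smooth_operator P /\
  forall c e f chi psi, local_data c e f chi psi ->
  forall (j : 'I_(frame_rank e)) (k : 'I_(frame_rank f)),
    let A := localization P c chi psi j k in
    is_quantization (chart_im c) A (full_symbol A) /\
    exists b0, classical_symbol (chart_im c) m (full_symbol A) b0.

Definition symbol_section : Type :=
  forall p : cotangent R n M, 'Hom(E p.1, F p.1).

(* sigma = sigma_m(P): in local coordinates sigma is the leading term of the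
   full symbol. *)
Definition principal_symbol (m : R) (P : operator) (sigma : symbol_section) :
    Prop :=
  forall c e f chi psi, local_data c e f chi psi ->
  forall (j : 'I_(frame_rank e)) (k : 'I_(frame_rank f)),
    classical_symbol (chart_im c) m
      (full_symbol (localization P c chi psi j k))
      (fun p => let x := chart_inv c p.1 in
         (chi x * psi x)%:C *
         coord (f x) k (sigma (x, covector X c x p.2) (tnth (e x) j))).

Definition elliptic (sigma : symbol_section) : Prop :=
  forall p : cotangent R n M, p.2 != 0 -> bijective (sigma p).

Context {gT : finGroupType} (a : smooth_action X gT).
Variables (aE : equivariant a E) (aF : equivariant a F).

Definition invariant_operator (P : operator) : Prop :=
  forall (g : gT) (s : section_of E), smooth_section s ->
    forall x, P (sact aE g s) x = sact aF g (P s) x.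

End Pseudodifferential.

Section AlphaElliptic.
Context {R : realType} {n : nat} {M : topologicalType} {X : atlas R n M}.
Context {gT : finGroupType} {a : smooth_action X gT}.

(* The representation rho acts on column vectors, v |-> rho h *m v. *)
Definition intertwiner (E : bundle X) (aE : equivariant a E)
    (p : cotangent R n M) d (rho : mx_representation R[i] (cstab a p) d)
    (T : 'Hom('cV[R[i]]_d, E p.1)) : Prop :=
  forall h (hx : a h p.1 = p.1), h \in cstab a p ->
    forall v, T (rho h *m v) = eact aE hx (T v).

(* The rho-isotypical component: the image of
   Hom_(Gamma_xi)(rho, E_x) (x) rho -> E_x. *)
Definition isotypical (E : bundle X) (aE : equivariant a E)
    (p : cotangent R n M) d (rho : mx_representation R[i] (cstab a p) d) :
    set (E p.1) :=
  [set v | exists k (T : 'I_k -> 'Hom('cV[R[i]]_d, E p.1)) (w : 'I_k -> 'cV_d),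
     (forall i, intertwiner aE rho (T i)) /\ v = \sum_(i < k) T i (w i)].

(* (xi, rho) \in X^alpha_(M, Gamma); the matrix B is a nonzero element of
   Hom_(Gamma_0)(g.rho, alpha), where (g.rho)(h) = rho (g^-1 h g) = rho (h ^ g). *)
Definition in_X (G0 : {group gT}) da
    (alpha : mx_representation R[i] [set: gT]%G da)
    (p : cotangent R n M) d (rho : mx_representation R[i] (cstab a p) d) : Prop :=
  p.2 != 0 /\
  exists g : gT, G0 \subset cstab a (cact a g p) /\
  exists B : 'M[R[i]]_(da, d), B != 0 /\
    forall h, h \in G0 -> B *m rho (h ^ g)%g = alpha h *m B.

Definition alpha_elliptic (E F : bundle X) (aE : equivariant a E)
    (aF : equivariant a F) (G0 : {group gT}) da
    (alpha : mx_representation R[i] [set: gT]%G da)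
    (sigma : symbol_section E F) : Prop :=
  forall (p : cotangent R n M) d (rho : mx_representation R[i] (cstab a p) d),
    mx_irreducible rho -> in_X G0 alpha rho ->
    set_bij (isotypical aE rho) (isotypical aF rho) (sigma p).

End AlphaElliptic.

(* Main.v *)
Require Import Defs.
From HB Require Import structures.
From mathcomp Require Import all_boot all_order all_algebra all_fingroup.
From mathcomp Require Import mxrepresentation.
From mathcomp Require Import all_classical all_reals all_analysis.
From mathcomp Require Import pgroup complex ring lra.
Set Implicit Arguments.
Unset Strict Implicit.
Unset Printing Implicit Defensive.
Import Order.TTheory GRing.Theory Num.Theory.
Import numFieldNormedType.Exports VectorInternalTheory.
Local Open Scope classical_set_scope.
Local Open Scope ring_scope.
Local Open Scope complex_scope.

(** A dense set meets the whole of M, so some point has trivial isotropy;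
minimality then forces Gamma_0 = 1 (minimal_isotropy_trivial).  Over the trivial
group every nonzero linear map is an intertwiner, so X^alpha contains all the
pairs (xi, rho) with xi != 0 (in_X_of_trivial), whatever alpha is.  It remains to
see, for a fixed xi != 0, that sigma(xi) is bijective if and only if it restricts
to a bijection between the rho-isotypical components for every irreducible
representation rho of Gamma_xi.

This is representation theory once sigma(xi) is known to be Gamma_xi-equivariant.
Averaging a pseudo-inverse S' of S = sigma(xi) over Gamma_xi makes 1 - S' S and
1 - S S' equivariant projections; a nonzero one would have an irreducible
submodule in its image, that is a nonzero vector of an isotypical component which
S kills, respectively which S does not reach (equivariant_inverse_exists,
bijective_of_isotypical).  Conversely, a bijective equivariant map and its inverse
both carry intertwiners to intertwiners (isotypical_of_bijective).

The equivariance of sigma (principal_symbol_equivariant) comes from the invariance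
of P.  The principal symbol is characterised in every chart and every pair of
frames, so no change of variables formula for symbols is involved: reading P in a
chart c with frames e, f and in the transported chart c o g^-1 with the
transported frames g e, g f gives the same full symbol, because P commutes with g
(full_symbol_push).  The leading term of a classical symbol is determined by the
symbol (leading_term_unique), so both readings have the same leading term.  These
leading terms are the matrices of sigma at xi and at g xi, multiplied by cutoff
functions; dividing by the cutoffs gives sigma(g xi) g = g sigma(xi).

The division needs a cutoff that does not vanish at the given point
(bump_exists).  It is built from exp(-1/t), whose smoothness, with the stability
of iterated directional derivatives under sums, products and compositions, is the
calculus part of the file.  The Hausdorff hypothesis makes the extension of a bump
function by zero outside a chart smooth. *)

(** * Irreducible subrepresentations and bijectivity *)

(** The matrices A h act on columns on the left, whereas submodules of a matrix
representation are row spaces, stable under right multiplication.  A simple row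
submodule of the row space of Q, split off by Maschke's theorem, gives through its
projection an intertwiner T from rho to A for the action on columns.  Q T is then a
nonzero intertwiner with values in the image of Q. *)
Lemma irreducible_quotient_exists (F : numFieldType) (gT : finGroupType)
    (H : {group gT}) n (A : mx_representation F H n) (Q : 'M[F]_n) :
  (forall h, h \in H -> A h *m Q = Q *m A h) -> Q != 0 ->
  exists d (rho : mx_representation F H d) (T : 'M[F]_(n, d)),
    [/\ mx_irreducible rho, forall h, h \in H -> A h *m T = T *m rho h
      & Q *m T != 0].
Proof.
move=> cQ nzQ.
have pH : ([pchar F]^'.-group H)%g.
  by rewrite /pgroup pcharf'_nat pnatr_eq0 -lt0n cardG_gt0.
have modQ : mxmodule A Q by apply/mxmoduleP => h Hh; rewrite -cQ // submxMl.
have [W simW sWQ] : exists2 W, mxsimple A W & (W <= Q)%MS.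
  apply/asboolP; apply: (mxsimple_exists modQ nzQ) => -[W simW sWQ].
  by apply/asboolP; exists W.
have modW := mxsimple_module simW.
have [V modV defV /mxdirect_addsP dxWV] := mx_Maschke_pchar A pH modW (submx1 W).
pose p := proj_mx W V.
have spW : (p <= W)%MS by rewrite -[p]mul1mx proj_mx_sub.
exists (\rank W), (submod_repr modW), (in_submod W p); split.
- exact/submod_mx_irr.
- move=> h Hh; rewrite -[RHS](in_submodJ modW) //.
  have /hom_mxP/(_ h Hh) : ((1%:M : 'M[F]_n) <= dom_hom_mx A p)%MS.
    by rewrite -defV; exact: proj_mx_hom.
  by rewrite !mul1mx => <-; rewrite /in_submod /= !mulmxA.
- have [_ nzW _] := simW; move: nzW; apply: contra_neq => QT0.
  have Qp0 : Q *m p = 0.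
    have sQpW : (Q *m p <= W)%MS by rewrite mulmx_sub.
    by rewrite -(in_submodK sQpW) /in_submod /= -mulmxA QT0 linear0.
  have [X defW] := submxP sWQ.
  by rewrite -(proj_mx_id dxWV (submx_refl W)) -/p defW -mulmxA Qp0 mulmx0.
Qed.

(** The identity S P S = S is preserved when P is averaged over the group. *)
Lemma equivariant_pinv_exists (F : numFieldType) (gT : finGroupType)
    (H : {group gT}) n1 n2 (A1 : mx_representation F H n1)
    (A2 : mx_representation F H n2) (S : 'M[F]_(n2, n1)) :
  (forall h, h \in H -> S *m A1 h = A2 h *m S) ->
  exists S' : 'M[F]_(n1, n2), S *m S' *m S = S /\
    forall h, h \in H -> S' *m A2 h = A1 h *m S'.
Proof.
move=> cS.
have nzH : (#|H|%:R : F) != 0 by rewrite pnatr_eq0 -lt0n cardG_gt0.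
have [P SPS] : exists P, S *m P *m S = S by exists (pinvmx S); rewrite mulmxKpV.
pose S' := #|H|%:R^-1 *: \sum_(h in H) A1 h *m P *m A2 (h^-1)%g.
exists S'; split.
  rewrite -scalemxAr -scalemxAl mulmx_sumr mulmx_suml (eq_bigr (fun=> S)).
    by rewrite sumr_const -[S *+ _]scaler_nat scalerA mulVf ?scale1r.
  move=> h Hh; rewrite !mulmxA -(mulmxA _ (A2 _) S) -cS ?groupV // (cS h) // !mulmxA.
  by rewrite -(mulmxA (A2 h)) -(mulmxA (A2 h)) SPS -cS // repr_mxK.
move=> h Hh; rewrite -scalemxAl -scalemxAr; congr (_ *: _).
rewrite mulmx_suml mulmx_sumr (reindex_inj (mulgI h)) /=.
apply: eq_big => k; first by rewrite groupMl.
rewrite groupMl // => Hk; rewrite -!mulmxA -repr_mxM ?groupV ?groupM //.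
by rewrite invMg mulgKV repr_mxM // !mulmxA.
Qed.

(** Irreducible subrepresentations detect bijectivity.  They are tested against the
equivariant maps 1 - S' S, whose image is the kernel of S, and 1 - S S', whose
kernel is the image of S. *)
Lemma equivariant_inverse_exists (F : numFieldType) (gT : finGroupType)
    (H : {group gT}) n1 n2 (A1 : mx_representation F H n1)
    (A2 : mx_representation F H n2) (S : 'M[F]_(n2, n1)) :
  (forall h, h \in H -> S *m A1 h = A2 h *m S) ->
  (forall d (rho : mx_representation F H d) (T : 'M[F]_(n1, d)) (w : 'cV[F]_d),
     mx_irreducible rho -> (forall h, h \in H -> A1 h *m T = T *m rho h) ->
     S *m (T *m w) = 0 -> T *m w = 0) ->
  (forall d (rho : mx_representation F H d) (T : 'M[F]_(n2, d)) (w : 'cV[F]_d),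
     mx_irreducible rho -> (forall h, h \in H -> A2 h *m T = T *m rho h) ->
     exists u, S *m u = T *m w) ->
  exists S', S' *m S = 1%:M /\ S *m S' = 1%:M.
Proof.
move=> cS injS surjS; have [S' [SSS cS']] := equivariant_pinv_exists cS.
have col_mul0 m k l (B : 'M[F]_(m, k)) (T : 'M[F]_(k, l)) :
    (forall w : 'cV[F]_l, B *m (T *m w) = 0) -> B *m T = 0.
  move=> BT0; apply/matrixP => i j.
  have := congr1 (fun v : 'cV[F]_m => v i 0) (BT0 (delta_mx j 0)).
  by rewrite mulmxA -colE !mxE.
exists S'; split; apply/eqP; rewrite eq_sym -subr_eq0; apply/negPn/negP => nzQ.
- have cQ h : h \in H -> A1 h *m (1%:M - S' *m S) = (1%:M - S' *m S) *m A1 h.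
    by move=> Hh; rewrite mulmxBr mulmxBl mulmx1 mul1mx mulmxA -cS' // -!mulmxA cS.
  have [d [rho [T [irr cT /eqP[]]]]] := irreducible_quotient_exists cQ nzQ.
  apply: col_mul0 => w; rewrite mulmxA; apply: (injS _ rho) => //.
    by move=> h Hh; rewrite mulmxA cQ // -(mulmxA _ (A1 h)) cT // mulmxA.
  by rewrite !mulmxA mulmxBr mulmx1 mulmxA SSS subrr !mul0mx.
- have cQ h : h \in H -> A2 h *m (1%:M - S *m S') = (1%:M - S *m S') *m A2 h.
    by move=> Hh; rewrite mulmxBr mulmxBl mulmx1 mul1mx mulmxA -cS // -!mulmxA cS'.
  have [d [rho [T [irr cT /eqP[]]]]] := irreducible_quotient_exists cQ nzQ.
  apply: col_mul0 => w; have [u <-] := surjS _ rho T w irr cT.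
  by rewrite mulmxA mulmxBl mul1mx SSS subrr mul0mx.
Qed.

(** * Calculus of iterated directional derivatives *)

Section Calculus.
Context {R : realType}.

Lemma near_eq_differentiable (V W : normedModType R) (f g : V -> W) (x : V) :
  (\forall y \near x, f y = g y) -> differentiable f x -> differentiable g x.
Proof.
move=> fg df; have [cdf fE] := (diff_locallyP _ _).1 df.
have gE : g \o shift x = cst (g x) + 'd f x +o_ 0 id.
  apply/eqaddoP => e e0; have /eqaddoP/(_ e e0) fe := fE.
  have fg0 : \forall h \near (0 : V), f (h + x) = g (h + x).
    by move: fg; rewrite (near_shift 0 x) subr0.
  apply: filterS2 fe fg0 => h; rewrite !fctE /= => + fgh.
  by rewrite fgh (nbhs_singleton fg).
have dE := diff_unique cdf gE.
by apply/diff_locallyP; rewrite dE.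
Qed.

Lemma near_iter_derive (V W : normedModType R) (f g : V -> W) l (x : V) :
  (\forall y \near x, f y = g y) ->
  \forall y \near x, iter_derive l f y = iter_derive l g y.
Proof.
move=> fg; elim: l => //= v l /near_join IH.
by apply: filterS IH => y; exact: near_eq_derive.
Qed.

Lemma iter_derive_rcons (V W : normedModType R) (f : V -> W) l v :
  iter_derive (rcons l v) f = iter_derive l ('D_v f).
Proof. by elim: l => //= w l ->. Qed.

(** The finite-order version of [smooth_on], on which induction is possible: the
product and chain rules express first derivatives through functions that are only
known to be one order less regular. *)
Definition diff_upto (V W : normedModType R) k (D : set V) (f : V -> W) :=
  forall l, (size l <= k)%N -> forall x, D x -> differentiable (iter_derive l f) x.

Lemma smooth_onE (V W : normedModType R) (D : set V) (f : V -> W) :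
  smooth_on D f <-> forall k, diff_upto k D f.
Proof.
split=> [sf k l _ x Dx|sf l x Dx]; first exact: sf.
exact: (sf (size l)).
Qed.

Section OpenDomain.
Variables (V : normedModType R) (D : set V).
Hypothesis oD : open D.

Lemma diff_upto0 (W : normedModType R) (f : V -> W) :
  diff_upto 0 D f <-> forall x, D x -> differentiable f x.
Proof. by split=> [df x|df [|] //]; exact: (df [::]). Qed.

(** Peeling off the innermost derivative, the one that is applied to f first. *)
Lemma diff_uptoS (W : normedModType R) k (f : V -> W) :
  diff_upto k.+1 D f <->
  (forall x, D x -> differentiable f x) /\ forall v, diff_upto k D ('D_v f).
Proof.
split=> [df|[df dDf] l].
  split=> [|v l lk x Dx]; first exact: (df [::]).
  by rewrite -iter_derive_rcons; apply: df => //; rewrite size_rcons.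
by case/lastP: l => [//|l v]; rewrite size_rcons iter_derive_rcons; exact: dDf.
Qed.

Lemma diff_upto_leq (W : normedModType R) j k (f : V -> W) :
  (j <= k)%N -> diff_upto k D f -> diff_upto j D f.
Proof. by move=> jk df l lj; apply: df; exact: leq_trans jk. Qed.

Lemma eq_diff_upto (W : normedModType R) k (f g : V -> W) :
  (forall x, D x -> f x = g x) -> diff_upto k D f -> diff_upto k D g.
Proof.
move=> fg df l lk x Dx; apply: near_eq_differentiable (df l lk x Dx).
by apply: near_iter_derive; apply: filterS (open_nbhs_nbhs (conj oD Dx)).
Qed.

Lemma diff_upto_cst (W : normedModType R) k (c : W) : diff_upto k D (cst c).
Proof.
elim: k c => [|k IH] c; first by apply/diff_upto0 => x _.
apply/diff_uptoS; split=> [x _ //|v].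
by apply: eq_diff_upto _ (IH 0) => x _; rewrite derive_cst.
Qed.

Lemma diff_uptoD (W : normedModType R) k (f g : V -> W) :
  diff_upto k D f -> diff_upto k D g -> diff_upto k D (fun x => f x + g x).
Proof.
elim: k f g => [|k IH] f g.
  move=> /diff_upto0 df /diff_upto0 dg; apply/diff_upto0 => x Dx.
  by apply: differentiableD; [exact: df|exact: dg].
move=> /diff_uptoS[df dDf] /diff_uptoS[dg dDg]; apply/diff_uptoS; split.
  by move=> x Dx; apply: differentiableD; [exact: df|exact: dg].
move=> v; apply: eq_diff_upto _ (IH _ _ (dDf v) (dDg v)) => x Dx.
by rewrite deriveD //; apply: diff_derivable; [exact: df|exact: dg].
Qed.

Lemma diff_upto_sum (W : normedModType R) k m (f : 'I_m -> V -> W) :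
  (forall i, diff_upto k D (f i)) -> diff_upto k D (fun x => \sum_i f i x).
Proof.
elim: m f => [|m IH] f df.
  apply: (@eq_diff_upto W k (cst 0) (fun x => \sum_i f i x)) => [x _|].
    by rewrite big_ord0.
  exact: diff_upto_cst.
apply: (@eq_diff_upto _ _ (fun x => f ord0 x + \sum_i f (lift ord0 i) x)).
  by move=> x _; rewrite big_ord_recl.
by apply: diff_uptoD => //; apply: IH.
Qed.

Lemma diff_uptoM k (f g : V -> R) :
  diff_upto k D f -> diff_upto k D g -> diff_upto k D (fun x => f x * g x).
Proof.
elim: k f g => [|k IH] f g.
  move=> /diff_upto0 df /diff_upto0 dg; apply/diff_upto0 => x Dx.
  by apply: differentiableM; [exact: df|exact: dg].
move=> df' dg'; have [df dDf] := (diff_uptoS _ _).1 df'.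
have [dg dDg] := (diff_uptoS _ _).1 dg'; apply/diff_uptoS; split.
  by move=> x Dx; apply: differentiableM; [exact: df|exact: dg].
have {}df' := diff_upto_leq (leqnSn k) df'.
have {}dg' := diff_upto_leq (leqnSn k) dg'.
move=> v; apply: eq_diff_upto _
  (diff_uptoD (IH _ _ df' (dDg v)) (IH _ _ dg' (dDf v))) => x Dx.
by rewrite deriveM //; apply: diff_derivable; [exact: df|exact: dg].
Qed.

Lemma diff_upto_coord k m (f : V -> 'rV[R]_m) i :
  diff_upto k D f -> diff_upto k D (fun x => f x 0 i).
Proof.
have dc g : (forall x, D x -> differentiable g x) ->
    forall x, D x -> differentiable (fun x => (g x : 'rV[R]_m) 0 i) x.
  move=> dg x Dx.
  exact: (differentiable_comp (dg x Dx) (differentiable_coord _ _ _)).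
elim: k f => [|k IH] f; first by rewrite !diff_upto0; exact: dc.
move=> /diff_uptoS[df dDf]; apply/diff_uptoS; split; first exact: dc.
move=> v; apply: eq_diff_upto _ (IH _ (dDf v)) => x Dx.
by rewrite derive_mx ?mxE //; apply: diff_derivable; exact: df.
Qed.

(** By the chain rule the derivative of g o f is the sum of the products
(D_i g o f) (D_v f)_i, to which the induction hypothesis and the product rule
apply. *)
Lemma diff_upto_comp_rV k m (U : set 'rV[R]_m) (f : V -> 'rV[R]_m)
    (g : 'rV[R]_m -> R) : (forall x, D x -> U (f x)) ->
  diff_upto k D f -> diff_upto k U g -> diff_upto k D (g \o f).
Proof.
move=> DU; have dc h : (forall y, U y -> differentiable h y) ->
    (forall x, D x -> differentiable f x) ->
    forall x, D x -> differentiable ((h : _ -> R) \o f) x.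
  move=> dh df x Dx; apply: differentiable_comp; first exact: df.
  by apply: dh; exact: DU.
elim: k g => [|k IH] g.
  by move=> /diff_upto0 df dg; apply/diff_upto0; apply: dc => // y; exact: (dg [::]).
move=> df' dg'; have [df dDf] := (diff_uptoS _ _).1 df'.
have dg y : U y -> differentiable g y by exact: (dg' [::]).
have dDg w : diff_upto k U ('D_w g).
  by move=> l lk; rewrite -iter_derive_rcons; apply: dg'; rewrite size_rcons.
apply/diff_uptoS; split; first exact: dc.
move=> v; have {}df' := diff_upto_leq (leqnSn k) df'.
apply: (@eq_diff_upto _ _
  (fun x => \sum_i ('D_(delta_mx 0 i) g \o f) x * ('D_v f x) 0 i)); last first.
  apply: diff_upto_sum => i.
  exact: diff_uptoM (IH _ df' (dDg _)) (diff_upto_coord _ (dDf v)).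
move=> x Dx; have dfx := df x Dx; have dgx := dg _ (DU _ Dx).
rewrite [RHS]deriveE; last exact: differentiable_comp.
rewrite (diff_comp dfx dgx) /= -(deriveE v dfx).
rewrite [in RHS](row_sum_delta ('D_v f x)) linear_sum.
by apply: eq_bigr => i _; rewrite linearZ /= -deriveE // mulrC.
Qed.

Lemma diff_upto_comp_real k (f : V -> R) (g : R -> R) :
  diff_upto k D f -> diff_upto k setT g -> diff_upto k D (g \o f).
Proof.
have dc h : (forall y, differentiable h y) ->
    (forall x, D x -> differentiable f x) ->
    forall x, D x -> differentiable ((h : R -> R) \o f) x.
  by move=> dh df x Dx; apply: differentiable_comp; [exact: df|exact: dh].
elim: k g => [|k IH] g.
  by move=> /diff_upto0 df dg; apply/diff_upto0; apply: dc => // y; exact: (dg [::]).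
move=> df' dg'; have [df dDf] := (diff_uptoS _ _).1 df'.
have dg y : differentiable g y by exact: (dg' [::]).
have dDg w : diff_upto k setT ('D_w g).
  by move=> l lk; rewrite -iter_derive_rcons; apply: dg'; rewrite size_rcons.
apply/diff_uptoS; split; first exact: dc.
move=> v; have {}df' := diff_upto_leq (leqnSn k) df'.
apply: eq_diff_upto _ (diff_uptoM (IH _ df' (dDg 1)) (dDf v)) => x Dx.
have dfx := df x Dx; have dgx := dg (f x).
rewrite [RHS]deriveE; last exact: differentiable_comp.
rewrite (diff_comp dfx dgx) /= -(deriveE v dfx) deriveE // mulrC.
rewrite -[X in _ = 'd g _ X]mulr1.
by rewrite -[X in _ = 'd g _ X]/('D_v f x *: (1 : R)) linearZ.
Qed.

End OpenDomain.
End Calculus.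

(** * Smooth functions of one variable *)

Section RealFunctions.
Context {R : realType}.

(** In one variable 'D_v f is v times f', so the induction on the order of
differentiation never leaves the class S, up to constant factors. *)
Lemma smooth_of_derivative_closed (S : set (R -> R)) :
  (forall f, S f -> exists2 f', S f' & forall x : R, is_derive x (1 : R) f (f' x)) ->
  forall f, S f -> smooth_on setT f.
Proof.
move=> SS f Sf; apply/smooth_onE => k.
elim: k f Sf => [|k IH] f Sf; have [f' Sf' df] := SS f Sf.
  by apply/diff_upto0 => x _; apply/derivable1_diffP; case: (df x).
apply/diff_uptoS; split=> [x _|v].
  by apply/derivable1_diffP; case: (df x).
apply: (eq_diff_upto openT (f := fun x => v * f' x)); last first.
  apply: (diff_uptoM openT); last exact: IH.
  exact: (diff_upto_cst openT).
move=> x _ /=.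
have dfx : differentiable f x by apply/derivable1_diffP; case: (df x).
have [_ <-] := df x; rewrite !deriveE //.
by rewrite -[X in _ = 'd f x X]mulr1 -[X in _ = 'd f _ X]/(v *: (1 : R)) linearZ.
Qed.

Lemma smooth_cos_sin (a b : R) : smooth_on setT (fun x => a * cos x + b * sin x).
Proof.
apply: (@smooth_of_derivative_closed
  [set f | exists a b : R, f = fun x => a * cos x + b * sin x]); last by exists a, b.
move=> _ [c [d ->]]; exists (fun x => d * cos x + (- c) * sin x).
  by exists d, (- c).
move=> x; apply: (@trigger_derive _ _ _ (c * - sin x + d * cos x)); last first.
  by rewrite mulrN mulNr addrC.
Qed.

(** The functions q(1/t) exp(-1/t), extended by 0 for t <= 0.  Polynomial factors
are allowed so that the class is stable under differentiation. *)
Definition flat (p : {poly R}) (t : R) : R :=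
  if 0 < t then p.[t^-1] * expR (- t^-1) else 0.

Lemma horner_le_expR (p : {poly R}) :
  exists C, forall s, 0 <= s -> `|p.[s]| <= C * expR s.
Proof.
(* s^i <= i! exp s for each monomial. *)
exists (\sum_(i < size p) `|p`_i| * i`!%:R) => s s0.
rewrite horner_coef mulr_suml (le_trans (ler_norm_sum _ _ _)) // ler_sum // => i _.
rewrite normrM -mulrA ler_wpM2l // ger0_norm ?exprn_ge0 //.
case: i => -[|i] /= _; first by rewrite expr0 mul1r -[1]expR0 ler_expR.
have /ltW : s ^+ i.+1 / (i.+1)`!%:R < expR s.
  by apply: lt_le_trans (expR_ge1Dxn i s0); rewrite ltrDr.
by rewrite ler_pdivrMr ?ltr0n ?fact_gt0 // mulrC.
Qed.

(** This is the bound p(s) s^2 = O(exp s) with s = 1/t; it gives the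
differentiability of flat functions at 0. *)
Lemma flat_quadratic (p : {poly R}) : exists C, forall t, `|flat p t| <= C * t ^+ 2.
Proof.
(* The factor 'X^2 is 1/t^2. *)
have [C pC] := horner_le_expR (p * 'X^2).
have C0 : 0 <= C.
  have := pC 0 (lexx _); rewrite expR0 mulr1; apply: le_trans; exact: normr_ge0.
exists C => t; rewrite /flat; case: ifPn => t0; last first.
  by rewrite normr0 mulr_ge0 ?sqr_ge0.
have := pC t^-1; rewrite invr_ge0 ltW // => /(_ isT).
have tV0 : 0 < t^-1 by rewrite invr_gt0.
rewrite hornerM hornerXn [`|_ * t^-1 ^+ 2|]normrM normrX (gtr0_norm tV0).
rewrite [in X in _ -> X]normrM (ger0_norm (expR_ge0 _)) expRN.
rewrite ler_pdivrMr ?expR_gt0 // -ler_pdivlMr ?exprn_gt0 //.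
by move=> /le_trans; apply; rewrite exprVn invrK mulrAC.
Qed.

Lemma flat_derive0 (p : {poly R}) : is_derive (0 : R) (1 : R) (flat p) 0.
Proof.
have [C pC] := flat_quadratic p.
have lim0 : (fun h => h^-1 *: (flat p (h *: 1 + 0) - flat p 0)) @ (0:R)^' --> (0 : R).
  have p0 : flat p 0 = 0 by rewrite /flat ltxx.
  apply/cvgrPdist_le => e e0.
  near=> h; rewrite p0 addr0 subr0 sub0r normrN [h *: 1]mulr1 normrM normfV.
  have h0 : h != 0 by near: h; exact: nbhs_dnbhs_neq.
  rewrite mulrC ler_pdivrMr ?normr_gt0 // (le_trans (pC h)) //.
  rewrite -real_normK ?num_real // expr2 mulrA ler_wpM2r //.
  have C1 : 0 < `|C| + 1 by rewrite ltr_wpDl.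
  rewrite (@le_trans _ _ ((`|C| + 1) * `|h|)) //.
    by rewrite ler_wpM2r // (le_trans (ler_norm C)) // lerDl.
  rewrite mulrC -ler_pdivlMr //.
  by near: h; apply: dnbhs0_le; rewrite divr_gt0.
apply: DeriveDef; first by apply/cvg_ex; exists 0.
exact/cvg_lim.
Unshelve. all: by end_near. Qed.

Lemma flat_derive (p : {poly R}) t :
  is_derive t (1 : R) (flat p) (flat (('X^2) * (p - p^`())) t).
Proof.
have [t0|t0|->] := ltgtP t 0.
- rewrite [X in is_derive _ _ _ X]/flat (lt_gtF t0).
  apply: (@near_eq_is_derive _ _ _ (cst 0)).
  by near=> s; rewrite /flat ifF //; apply: lt_gtF; near: s; exact: lt_nbhsl.
- rewrite [X in is_derive _ _ _ X]/flat t0.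
  apply: (@near_eq_is_derive _ _ _
    ((horner p \o (fun s : R => s^-1)) * (expR \o (fun s : R => - s^-1)))).
    by near=> s; rewrite /flat ifT //; near: s; exact: lt_nbhsr.
  have dV : is_derive t (1 : R) (fun s : R => s^-1) (- t ^- 2).
    have := @is_deriveV R id t 1 1 (lt0r_neq0 t0) _.
    by rewrite [_ *: _]mulr1; apply.
  have dN : is_derive t (1 : R) (fun s : R => - s^-1) (t ^- 2).
    by rewrite -[X in is_derive _ _ _ X]opprK; exact: is_deriveN.
  have dp := @is_derive1_comp _ (horner p) _ t _ _ (is_derive_poly p t^-1) dV.
  have de := @is_derive1_comp _ expR _ t _ _ (is_derive_expR (- t^-1)) dN.
  apply: (trigger_derive (is_deriveM dp de)).
  rewrite !hornerE /= exprVn /GRing.scale /=; ring.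
- by rewrite [X in is_derive _ _ _ X]/flat ltxx; exact: flat_derive0.
Unshelve. all: by end_near. Qed.

Lemma smooth_flat (p : {poly R}) : smooth_on setT (flat p).
Proof.
apply: (@smooth_of_derivative_closed [set f | exists p, f = flat p]); last by exists p.
move=> _ [q ->]; exists (flat ('X^2 * (q - q^`()))); first by exists ('X^2 * (q - q^`())).
exact: flat_derive.
Qed.

End RealFunctions.

(** * Smooth functions on row vectors *)

Section SmoothOn.
Context {R : realType} {V : normedModType R}.

Lemma smooth_on_sub (W : normedModType R) (D D' : set V) (f : V -> W) :
  D `<=` D' -> smooth_on D' f -> smooth_on D f.
Proof. by move=> sDD' sf l x /sDD'; exact: sf. Qed.

Lemma smooth_on_local (W : normedModType R) (D : set V) (f : V -> W) :
  (forall x, D x -> exists2 U, U x & smooth_on U f) -> smooth_on D f.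
Proof. by move=> Df l x /Df[U Ux]; apply. Qed.

Lemma eq_smooth_on (W : normedModType R) (D : set V) (f g : V -> W) :
  open D -> (forall x, D x -> f x = g x) -> smooth_on D f -> smooth_on D g.
Proof.
move=> oD fg /smooth_onE sf; apply/smooth_onE => k.
exact: (@eq_diff_upto _ _ _ oD _ k f).
Qed.

Lemma smooth_on_cst (W : normedModType R) (D : set V) (w : W) :
  open D -> smooth_on D (fun=> w).
Proof. by move=> oD; apply/smooth_onE => k; exact: (diff_upto_cst oD). Qed.

Lemma smooth_onD (D : set V) (f g : V -> R) : open D ->
  smooth_on D f -> smooth_on D g -> smooth_on D (fun x => f x + g x).
Proof.
move=> oD /smooth_onE sf /smooth_onE sg; apply/smooth_onE => k.
exact: (@diff_uptoD _ _ _ oD _ k f g).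
Qed.

Lemma smooth_onM (D : set V) (f g : V -> R) : open D ->
  smooth_on D f -> smooth_on D g -> smooth_on D (fun x => f x * g x).
Proof.
move=> oD /smooth_onE sf /smooth_onE sg; apply/smooth_onE => k.
exact: (@diff_uptoM _ _ _ oD k f g).
Qed.

Lemma smooth_onN (D : set V) (f : V -> R) : open D ->
  smooth_on D f -> smooth_on D (fun x => - f x).
Proof.
move=> oD sf; apply: (@eq_smooth_on _ _ (fun x => -1 * f x)) => //.
  by move=> x _; rewrite mulN1r.
by apply: smooth_onM => //; exact: smooth_on_cst.
Qed.

Lemma smooth_on_sum (D : set V) m (f : 'I_m -> V -> R) : open D ->
  (forall i, smooth_on D (f i)) -> smooth_on D (fun x => \sum_i f i x).
Proof.
move=> oD sf; apply/smooth_onE => k.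
by apply: (@diff_upto_sum _ _ _ oD _ k m f) => i; move: k; exact/smooth_onE.
Qed.

Lemma smooth_on_comp_rV m (D : set V) (U : set 'rV[R]_m) (f : V -> 'rV[R]_m)
    (g : 'rV[R]_m -> R) : open D -> (forall x, D x -> U (f x)) ->
  smooth_on D f -> smooth_on U g -> smooth_on D (g \o f).
Proof.
move=> oD DU /smooth_onE sf /smooth_onE sg; apply/smooth_onE => k.
exact: (@diff_upto_comp_rV _ _ _ oD k m U f g).
Qed.

Lemma smooth_on_comp_real (D : set V) (f : V -> R) (g : R -> R) : open D ->
  smooth_on D f -> smooth_on setT g -> smooth_on D (g \o f).
Proof.
move=> oD /smooth_onE sf /smooth_onE sg; apply/smooth_onE => k.
exact: (@diff_upto_comp_real _ _ _ oD k f g).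
Qed.

End SmoothOn.

Section SmoothRow.
Context {R : realType} {n : nat}.

Lemma smooth_on_coord (D : set 'rV[R]_n) i : open D ->
  smooth_on D (fun y : 'rV[R]_n => y 0 i).
Proof.
move=> oD; apply/smooth_onE => k.
apply: (@diff_upto_coord _ _ _ oD k n id i); case: k => [|k].
  by apply/diff_upto0 => x _; exact: ex_diff.
apply/diff_uptoS; split=> [x _|v]; first exact: ex_diff.
apply: (@eq_diff_upto _ _ _ oD _ k (cst v)) => [x _|].
  by rewrite derive_id.
exact: (diff_upto_cst oD).
Qed.

Lemma smooth_on_dotp (D : set 'rV[R]_n) (xi : 'rV[R]_n) : open D ->
  smooth_on D (fun y => dotp y xi).
Proof.
move=> oD.
apply: (@eq_smooth_on _ _ _ _ (fun y : 'rV[R]_n => \sum_i y 0 i * xi 0 i)) => //.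
  by move=> y _; rewrite /dotp mxE; apply: eq_bigr => i _; rewrite mxE.
apply: smooth_on_sum => // i; apply: smooth_onM => //; first exact: smooth_on_coord.
exact: smooth_on_cst.
Qed.

Lemma csmooth_plane_wave (xi : 'rV[R]_n) : csmooth_on setT (plane_wave xi).
Proof.
have s (h : R -> R) : smooth_on setT h -> smooth_on setT (fun y => h (dotp y xi)).
  move=> sh; apply: (@smooth_on_comp_real _ _ _ (fun y => dotp y xi) h) => //.
    exact: openT.
  by apply: smooth_on_dotp; exact: openT.
split; apply: s.
- apply: (@eq_smooth_on _ _ _ _ (fun x => 1 * cos x + 0 * sin x)); first exact: openT.
    by move=> x _; rewrite mul1r mul0r addr0.
  exact: smooth_cos_sin.
- apply: (@eq_smooth_on _ _ _ _ (fun x => 0 * cos x + 1 * sin x)); first exact: openT.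
    by move=> x _; rewrite mul1r mul0r add0r.
  exact: smooth_cos_sin.
Qed.

(** The function flat 1 (s^2 - |y - y0|^2), for the Euclidean norm; its support lies
in the ball of radius s for the sup norm, since the latter is smaller. *)
Lemma bump_rV (y0 : 'rV[R]_n) (s : R) : 0 < s -> exists phi : 'rV[R]_n -> R,
  [/\ smooth_on setT phi, phi y0 != 0 &
      forall y, phi y != 0 -> `|y0 - y| <= s].
Proof.
move=> s0; exists (flat 1 \o (fun y : 'rV[R]_n =>
  s ^+ 2 + - \sum_i (y 0 i + - y0 0 i) * (y 0 i + - y0 0 i))).
split.
- apply: smooth_on_comp_real; [exact: openT| |exact: smooth_flat].
  apply: smooth_onD; [exact: openT|exact: smooth_on_cst openT|].
  apply: smooth_onN; first exact: openT.
  apply: smooth_on_sum => [|i]; first exact: openT.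
  suff sc : smooth_on setT (fun y : 'rV[R]_n => y 0 i + - y0 0 i).
    by apply: smooth_onM; first exact: openT.
  apply: smooth_onD; [exact: openT|exact: smooth_on_coord openT|].
  exact: smooth_on_cst openT.
- rewrite /= big1 => [|i _]; last by rewrite subrr mul0r.
  rewrite oppr0 addr0 /flat exprn_gt0 // hornerC mul1r.
  by rewrite gt_eqF ?expR_gt0.
- move=> y; rewrite /= /flat; case: ifPn => [|_]; last by rewrite eqxx.
  rewrite subr_gt0 => lts _; rewrite [leLHS]/Num.Def.normr /= mx_normrE.
  rewrite bigmax_le ?ltW // => -[i j] _ /=.
  rewrite !ord1 !mxE -ler_sqr ?nnegrE ?(ltW s0) // real_normK ?num_real //.
  apply: le_trans (ltW lts); rewrite (bigD1 j) //= -opprB sqrrN expr2 lerDl.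
  by rewrite sumr_ge0 // => k _; rewrite -expr2 sqr_ge0.
Qed.

End SmoothRow.

(** * Smooth functions and bump functions on a manifold *)

Section SmoothFun.
Context {R : realType} {n : nat} {M : topologicalType} {X : atlas R n M}.
Implicit Types (c : chart R n M) (U V : set M) (f g : M -> R).

(** The image is the intersection of the image of the chart with the preimage of U
under the inverse of the chart. *)
Lemma open_chart_image c U : open U -> open (c @` (chart_dom c `&` U)).
Proof.
move=> oU; rewrite openE => _ [x [cx Ux] <-].
have xU : nbhs x U by exact: open_nbhs_nbhs.
have nim : nbhs (c x) (chart_im c).
  by apply: open_nbhs_nbhs; split; [exact: chart_im_open|exists x].
apply: filterS2 nim (chart_inv_nbhs cx xU) => _ [y cy <-].
by rewrite chart_mapK // => Uy; exists y.
Qed.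

Lemma smooth_fun_local U f :
  (forall x, U x -> exists2 V, open V /\ V x & smooth_fun X V f) ->
  smooth_fun X U f.
Proof.
move=> lf x; apply: smooth_on_local => _ [z [xz Uz] <-].
have [V [oV Vz] sf] := lf z Uz.
by exists (chart_at X x @` (chart_dom (chart_at X x) `&` V)); [exists z|exact: sf].
Qed.

Lemma eq_smooth_fun U f g : open U -> (forall x, U x -> f x = g x) ->
  smooth_fun X U f -> smooth_fun X U g.
Proof.
move=> oU fg sf x; apply: eq_smooth_on (sf x); first exact: open_chart_image.
by move=> _ [z [xz Uz] <-]; rewrite /= chart_mapK // fg.
Qed.

Lemma smooth_fun_sub U V f : U `<=` V -> smooth_fun X V f -> smooth_fun X U f.
Proof.
move=> UV sf x; apply: smooth_on_sub (sf x) => _ [z [xz Uz] <-].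
by exists z => //; split => //; exact: UV.
Qed.

Lemma smooth_fun_cst U (k : R) : open U -> smooth_fun X U (fun=> k).
Proof. by move=> oU x; apply: smooth_on_cst; exact: open_chart_image. Qed.

Lemma smooth_funM U f g : open U -> smooth_fun X U f -> smooth_fun X U g ->
  smooth_fun X U (fun x => f x * g x).
Proof.
move=> oU sf sg x; have := smooth_onM _ (sf x) (sg x).
by apply; exact: open_chart_image.
Qed.

Lemma smooth_funD U f g : open U -> smooth_fun X U f -> smooth_fun X U g ->
  smooth_fun X U (fun x => f x + g x).
Proof.
move=> oU sf sg x; have := smooth_onD _ (sf x) (sg x).
by apply; exact: open_chart_image.
Qed.

Lemma smooth_funN U f : open U -> smooth_fun X U f ->
  smooth_fun X U (fun x => - f x).
Proof.
move=> oU sf x; have := smooth_onN _ (sf x).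
by apply; exact: open_chart_image.
Qed.

(** Near each point z, with w = h z, read the function in the chart at w and the map
h between the charts at x and w; then use the chain rule in coordinates. *)
Lemma smooth_fun_comp U f (h : M -> M) : open U -> smooth_map X h ->
  smooth_fun X U f -> smooth_fun X (h @^-1` U) (f \o h).
Proof.
move=> oU [ch sh] sf x; apply: smooth_on_local => _ [z [xz Uz] <-].
set w := h z; set cx := chart_at X x; set cw := chart_at X w.
have oV : open (h @^-1` (chart_dom cw `&` U)).
  by apply: open_comp; [move=> y _; exact: ch|apply: openI => //; exact: chart_dom_open].
exists (cx @` (chart_dom cx `&` h @^-1` (chart_dom cw `&` U))).
  by exists z => //; split => //; split => //; exact: chart_at_mem.
apply: (@eq_smooth_on _ _ _ _ ((f \o chart_inv cw) \o chart_expr X h x w)).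
- exact: open_chart_image.
- by move=> _ [y [xy [wy Uy]] <-]; rewrite /chart_expr /= chart_mapK // chart_mapK.
- apply: (@smooth_on_comp_rV _ _ _ _ (cw @` (chart_dom cw `&` U))).
  + exact: open_chart_image.
  + move=> _ [y [xy [wy Uy]] <-]; rewrite /chart_expr /= chart_mapK //.
    by exists (h y).
  + apply: smooth_on_sub (sh x w) => _ [y [xy [wy Uy]] <-].
    by exists y.
  + exact: sf.
Qed.

(** The transition maps from the preferred charts to c are smooth. *)
Lemma smooth_fun_chart c (phi : 'rV[R]_n -> R) : is_chart X c ->
  smooth_on (chart_im c) phi -> smooth_fun X (chart_dom c) (phi \o c).
Proof.
move=> Xc sphi x; have [_ xc] := Xc x; set cx := chart_at X x in xc *.
apply: (@eq_smooth_on _ _ _ _ (phi \o (c \o chart_inv cx))) => //.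
  by apply: open_chart_image; exact: chart_dom_open.
apply: (@smooth_on_comp_rV _ _ _ _ (chart_im c)) => //.
  by apply: open_chart_image; exact: chart_dom_open.
by move=> _ [y [xy cy] <-] /=; rewrite chart_mapK //; exists y.
Qed.

Section Restriction.
Variables (c : chart R n M) (U : set M).
Hypothesis oU : open U.

Lemma chart_restr_inv_cont (y : 'rV[R]_n) :
  (c @` (chart_dom c `&` U)) y -> {for y, continuous (chart_inv c)}.
Proof. by move=> [x [cx _] <-]; apply: chart_inv_cont; exists x. Qed.

Definition chart_restr : chart R n M :=
  @Chart R n M (chart_dom c `&` U) c (chart_inv c)
    (openI (chart_dom_open c) oU) (open_chart_image oU)
    (fun x cUx => chart_mapK cUx.1) (fun x cUx => chart_map_cont cUx.1)
    chart_restr_inv_cont.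

Lemma is_chart_restr : is_chart X c -> is_chart X chart_restr.
Proof.
move=> Xc x; have [cx xc] := Xc x; split.
  by apply: smooth_on_sub cx => _ [y [[cy Uy] xy] <-]; exists y.
by apply: smooth_on_sub xc => _ [y [xy [cy Uy]] <-]; exists y.
Qed.

End Restriction.

Lemma is_chart_at x : is_chart X (chart_at X x).
Proof. by move=> y; split; exact: chart_at_compat. Qed.

(** Transport a bump function of small support to M by the chart and extend it by
zero.  Its support is contained in the image K of a closed ball; K is compact,
hence closed because M is Hausdorff, so that the extension is smooth: it vanishes
on the open set ~` K, which together with the chart covers M. *)
Lemma bump_exists (x : M) U : hausdorff_space M -> open U -> U x ->
  exists chi : M -> R,
    [/\ smooth_fun X setT chi, closure [set z | chi z != 0] `<=` U & chi x != 0].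
Proof.
move=> hM oU Ux; pose c := chart_restr (chart_at X x) oU.
have Xc : is_chart X c by apply: is_chart_restr; exact: is_chart_at.
have cx : chart_dom c x by split => //; exact: chart_at_mem.
have imx : nbhs (c x) (chart_im c).
  by apply: open_nbhs_nbhs; split; [exact: chart_im_open|exists x].
have [r r0 rim] : exists2 r : R, 0 < r & forall y, `|c x - y| <= r -> chart_im c y.
  have /nbhs_ballP[e /= e0 eim] := imx.
  exists (e / 2); first by rewrite divr_gt0.
  move=> y cy; apply: eim; rewrite -ball_normE /=; apply: le_lt_trans cy _.
  by rewrite ltr_pdivrMr // ltr_pMr // ltr1n.
have [phi [sphi phix phir]] := bump_rV (c x) r0.
pose B := [set y : 'rV[R]_n | `|c x - y| <= r].
have cB : compact B.
  apply: bounded_closed_compact.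
    exists (`|c x| + r); split; first by rewrite num_real.
    move=> t ht y By; have := ler_normB (c x) (c x - y).
    rewrite subKr => /le_trans; apply.
    by rewrite (le_trans _ (ltW ht)) // lerD2l.
  have -> : B = (fun y => `|c x - y|) @^-1` [set t | t <= r] by [].
  apply: closed_comp; last exact: closed_le.
  move=> y _; apply: continuous_comp; last exact: norm_continuous.
  by apply: (@continuousB _ _ _ (cst (c x)) id); [exact: cst_continuous|exact: cvg_id].
pose K := chart_inv c @` B.
have KU : K `<=` chart_dom c.
  by move=> _ [y /rim[z cz <-] <-]; rewrite chart_mapK.
have clK : closed K.
  apply: compact_closed => //; apply: continuous_compact cB.
  apply: continuous_in_subspaceT => y /set_mem By.
  by apply: chart_inv_cont; exact: rim.
pose chi z := if z \in chart_dom c then phi (c z) else 0.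
have chiK : [set z | chi z != 0] `<=` K.
  move=> z; rewrite /chi /=; case: ifPn => [/set_mem cz /phir|_]; last by rewrite eqxx.
  by exists (c z) => //; rewrite chart_mapK.
exists chi; split.
- apply: smooth_fun_local => z _; have [cz|ncz] := pselect (chart_dom c z).
    exists (chart_dom c); first by split => //; exact: chart_dom_open.
    apply: (@eq_smooth_fun _ (phi \o c)); first exact: chart_dom_open.
      by move=> y cy; rewrite /chi mem_set.
    by apply: smooth_fun_chart => //; exact: smooth_on_sub sphi.
  exists (~` K); first by split; [exact: closed_openC|by move/KU].
  apply: (@eq_smooth_fun _ (fun=> 0)); first exact: closed_openC.
    by move=> y; apply: contra_notP => chiy; apply: chiK; apply/eqP => /esym.
  by apply: smooth_fun_cst; exact: closed_openC.
- apply: subset_trans (@subIsetr _ (chart_dom (chart_at X x)) U).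
  apply: subset_trans KU; rewrite [X in _ `<=` X](closure_id K).1 //.
  exact: closure_subset.
- by rewrite /chi mem_set.
Qed.

End SmoothFun.

(** * Uniqueness of the leading term of a classical symbol *)

Section LeadingTerm.
Context {R : realType} {n : nat}.
Local Notation V := 'rV[R]_n.

(** Write 1 + t r = t (1/t + r), where 1/t + r stays between r and 1 + r. *)
Lemma powR_shift_bound (m r : R) : 0 < r ->
  exists C, forall t, 1 <= t -> (1 + t * r) `^ m <= C * t `^ m.
Proof.
move=> r0.
(* The logarithm of 1/t + r lies between ln r and ln (1 + r), so this constant
   serves for both signs of m. *)
exists (expR (`|m| * (`|ln r| + `|ln (1 + r)|))) => t t1.
have t0 : 0 < t by exact: lt_le_trans t1.
have -> : 1 + t * r = (t^-1 + r) * t by rewrite mulrDl mulVf ?gt_eqF // mulrC.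
have s0 : 0 < t^-1 + r by rewrite addr_gt0 ?invr_gt0.
rewrite powRM ?(ltW s0) ?(ltW t0) // ler_wpM2r ?powR_ge0 //.
rewrite /powR gt_eqF // ler_expR (le_trans (ler_norm _)) // normrM ler_wpM2l //.
have rs : ln r <= ln (t^-1 + r) by rewrite ler_ln ?posrE // lerDr invr_ge0 ltW.
have s1 : ln (t^-1 + r) <= ln (1 + r).
  have p1 : 0 < 1 + r by rewrite addr_gt0.
  by rewrite ler_ln ?posrE // lerD2r invf_le1.
rewrite ler_norml; apply/andP; split.
  have := ler_norm (- ln r); have := normr_ge0 (ln (1 + r)); rewrite normrN; lra.
have := ler_norm (ln (1 + r)); have := normr_ge0 (ln r); lra.
Qed.

(** t^m A cannot be O(t^(m-1)) as t tends to infinity unless A = 0; here r is the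
length of the covector along whose ray the symbol is evaluated. *)
Lemma homogeneous_small_eq0 (m A c r : R) : 0 < r ->
  (forall t, 1 <= t -> 1 <= t * r ->
    `|t `^ m * A| <= c * (1 + t * r) `^ (m - 1)) -> A = 0.
Proof.
move=> r0 Ac; have [C HC] := powR_shift_bound (m - 1) r0.
apply/eqP; rewrite -normr_le0 leNgt; apply/negP => A0.
(* The bound reads t `|A| <= `|c| C, which fails for this large t. *)
pose t := 1 + r^-1 + (`|c| * C) / `|A|.
have C0 : 0 <= C.
  have := HC 1 (lexx _); rewrite powR1 mulr1; apply: le_trans; exact: powR_ge0.
have q0 : 0 <= `|c| * C / `|A| by rewrite !mulr_ge0 ?invr_ge0.
have t1 : 1 <= t by rewrite /t -addrA lerDl addr_ge0 // invr_ge0 ltW.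
have t0 : 0 < t by exact: lt_le_trans t1.
have tr : 1 <= t * r.
  by rewrite -ler_pdivrMr // div1r /t -addrA addrCA lerDl addr_ge0.
have := Ac t t1 tr; rewrite normrM ger0_norm ?powR_ge0 // => h.
have {}h : t `^ m * `|A| <= `|c| * (C * t `^ (m - 1)).
  apply: le_trans h _; apply: (@le_trans _ _ (`|c| * (1 + t * r) `^ (m - 1))).
    by rewrite ler_wpM2r ?powR_ge0 ?ler_norm.
  by rewrite ler_wpM2l // HC.
have tm : t `^ m = t * t `^ (m - 1).
  rewrite -[X in _ = X * _](powRr1 (ltW t0)) -powRD ?subrKC //.
  by rewrite (gt_eqF t0) implybT.
move: h; rewrite tm mulrA [leLHS]mulrAC ler_pM2r ?powR_gt0 // -ler_pdivlMr //.
by rewrite leNgt /t ltrDr addr_gt0 ?invr_gt0.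
Qed.

(** The difference of the leading parts f0 and g0 is homogeneous of degree m, and the
two symbol bounds show that it is of order m - 1. *)
Lemma leading_part_unique (D : set V) (m : R) (y xi : V)
    (f g f0 g0 : V * V -> R) : D y -> xi != 0 ->
  (forall xi, f (y, xi) = g (y, xi)) ->
  symbol_bound D (m - 1) (fun p => f p - f0 p) ->
  symbol_bound D (m - 1) (fun p => g p - g0 p) ->
  (forall t, 0 < t -> f0 (y, t *: xi) = t `^ m * f0 (y, xi)) ->
  (forall t, 0 < t -> g0 (y, t *: xi) = t `^ m * g0 (y, xi)) ->
  f0 (y, xi) = g0 (y, xi).
Proof.
move=> Dy xi0 fg bf bg hf hg.
have cy : compact [set y] by exact: compact_set1.
have yD : [set y] `<=` D by move=> _ ->.
have [c1 H1] := bf _ [::] [::] cy yD; have [c2 H2] := bg _ [::] [::] cy yD.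
apply/eqP; rewrite -subr_eq0; apply/eqP.
apply: (@homogeneous_small_eq0 m _ (c1 + c2) `|xi|); first by rewrite normr_gt0.
move=> t t1 txi; have t0 : 0 < t by exact: lt_le_trans t1.
have ntxi : `|t *: xi| = t * `|xi| by rewrite normrZ gtr0_norm.
have txi1 : 1 <= `|t *: xi| by rewrite ntxi.
have := H1 y _ erefl txi1; have := H2 y _ erefl txi1.
rewrite /mixed_derive /= ntxi subr0 mulrDl => h2 h1.
rewrite mulrBr -hf // -hg //; rewrite fg in h1; apply: le_trans (lerD h1 h2).
set u := f0 _; set v := g0 _; set w := g _.
have -> : u - v = (w - v) - (w - u) by ring.
by rewrite [leRHS]addrC ler_normB.
Qed.

(** The remainder after one term of the expansion is of order m - 1, which is what
[leading_part_unique] compares; real and imaginary parts are treated separately. *)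
Lemma leading_term_unique (D : set V) (m : R) (b b' b0 b0' : V * V -> R[i]) :
  (forall y xi, D y -> b (y, xi) = b' (y, xi)) ->
  classical_symbol D m b b0 -> classical_symbol D m b' b0' ->
  forall y xi, D y -> xi != 0 -> b0 (y, xi) = b0' (y, xi).
Proof.
move=> bb' [_ [bs [bs0 _ hbs Rbs]]] [_ [bs' [bs0' _ hbs' Rbs']]] y xi Dy xi0.
rewrite -bs0 // -bs0' //.
have hR t (z : R[i]) : complex.Re (t%:C * z) = t * complex.Re z.
  by case: z => u v /=; rewrite mul0r subr0.
have hI t (z : R[i]) : complex.Im (t%:C * z) = t * complex.Im z.
  by case: z => u v /=; rewrite mul0r addr0.
have RB (u v : R[i]) : complex.Re (u - v) = complex.Re u - complex.Re v.
  by case: u => ? ?; case: v.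
have IB (u v : R[i]) : complex.Im (u - v) = complex.Im u - complex.Im v.
  by case: u => ? ?; case: v.
have [[R1 I1] [R2 I2]] := (Rbs 1%N, Rbs' 1%N).
apply/eqP; rewrite eq_complex; apply/andP; split; apply/eqP.
- apply: (@leading_part_unique D m y xi (fun p => complex.Re (b p))
    (fun p => complex.Re (b' p)) (fun p => complex.Re (bs 0%N p))
    (fun p => complex.Re (bs' 0%N p)) Dy xi0).
  + by move=> eta; rewrite bb'.
  + by congr (symbol_bound D _ _) : R1; apply/funext => p; rewrite big_ord1 RB.
  + by congr (symbol_bound D _ _) : R2; apply/funext => p; rewrite big_ord1 RB.
  + by move=> t t0; rewrite hbs // subr0 hR.
  + by move=> t t0; rewrite hbs' // subr0 hR.
- apply: (@leading_part_unique D m y xi (fun p => complex.Im (b p))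
    (fun p => complex.Im (b' p)) (fun p => complex.Im (bs 0%N p))
    (fun p => complex.Im (bs' 0%N p)) Dy xi0).
  + by move=> eta; rewrite bb'.
  + by congr (symbol_bound D _ _) : I1; apply/funext => p; rewrite big_ord1 IB.
  + by congr (symbol_bound D _ _) : I2; apply/funext => p; rewrite big_ord1 IB.
  + by move=> t t0; rewrite hbs // subr0 hI.
  + by move=> t t0; rewrite hbs' // subr0 hI.
Qed.

End LeadingTerm.

(** * Smooth complex functions and localized sections *)

Section CSmoothFun.
Context {R : realType} {n : nat} {M : topologicalType} {X : atlas R n M}.
Implicit Types (U V : set M) (f g : M -> R[i]).

Lemma csmooth_fun_local U f :
  (forall x, U x -> exists2 V, open V /\ V x & csmooth_fun X V f) ->
  csmooth_fun X U f.
Proof.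
by move=> lf; split; apply: smooth_fun_local => x /lf[V oV [sr si]]; exists V.
Qed.

Lemma eq_csmooth_fun U f g : open U -> (forall x, U x -> f x = g x) ->
  csmooth_fun X U f -> csmooth_fun X U g.
Proof.
by move=> oU fg [sr si]; split; [apply: eq_smooth_fun sr|apply: eq_smooth_fun si];
  move=> // x Ux; rewrite fg.
Qed.

Lemma csmooth_fun_sub U V f : U `<=` V -> csmooth_fun X V f -> csmooth_fun X U f.
Proof. by move=> UV [sr si]; split; apply: smooth_fun_sub UV _. Qed.

Lemma csmooth_fun_comp U f (h : M -> M) : open U -> smooth_map X h ->
  csmooth_fun X U f -> csmooth_fun X (h @^-1` U) (f \o h).
Proof.
move=> oU sh [sr si]; split.
  exact: (@smooth_fun_comp _ _ _ _ U (fun x => complex.Re (f x))).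
exact: (@smooth_fun_comp _ _ _ _ U (fun x => complex.Im (f x))).
Qed.

Lemma csmooth_fun_real U (f : M -> R) : open U -> smooth_fun X U f ->
  csmooth_fun X U (fun x => (f x)%:C).
Proof. by move=> oU sf; split => //; exact: smooth_fun_cst. Qed.

Lemma csmooth_funM U f g : open U -> csmooth_fun X U f -> csmooth_fun X U g ->
  csmooth_fun X U (fun x => f x * g x).
Proof.
move=> oU [fr fi] [gr gi]; split.
- apply: (@eq_smooth_fun _ _ _ _ U (fun x =>
    complex.Re (f x) * complex.Re (g x) + - (complex.Im (f x) * complex.Im (g x)))) => //.
    by move=> x _; case: (f x) => ? ?; case: (g x) => ? ?.
  by apply: smooth_funD => //; [|apply: smooth_funN => //]; apply: smooth_funM.
- apply: (@eq_smooth_fun _ _ _ _ U (fun x =>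
    complex.Re (f x) * complex.Im (g x) + complex.Im (f x) * complex.Re (g x))) => //.
    by move=> x _; case: (f x) => ? ?; case: (g x) => ? ?.
  by apply: smooth_funD => //; apply: smooth_funM.
Qed.

Lemma csmooth_fun_plane_wave (c : chart R n M) (xi : 'rV[R]_n) : is_chart X c ->
  csmooth_fun X (chart_dom c) (plane_wave xi \o c).
Proof.
move=> Xc; have [sr si] := csmooth_plane_wave xi; split.
  apply: (@smooth_fun_chart _ _ _ _ c (fun y => complex.Re (plane_wave xi y))) => //.
  exact: smooth_on_sub sr.
apply: (@smooth_fun_chart _ _ _ _ c (fun y => complex.Im (plane_wave xi y))) => //.
exact: smooth_on_sub si.
Qed.

(** The sections on which the operator is evaluated to form its full symbol; the
cutoff makes them vanish near the complement of the chart, and smooth there. *)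
Lemma smooth_localized_section (E : bundle X) (c : chart R n M) (e : frame E)
    (psi : M -> R) (xi : 'rV[R]_n) (j : 'I_(frame_rank e)) :
  is_chart X c -> is_frame e -> chart_dom c `<=` frame_dom e -> cutoff (X := X) c psi ->
  smooth_section (fun z => ((psi z)%:C * plane_wave xi (c z)) *: tnth (e z) j).
Proof.
move=> Xc Xe ce [spsi psic] x k; apply: csmooth_fun_local => y xy.
have [cy|ncy] := pselect (chart_dom c y).
  have oV : open (chart_dom c `&` frame_dom (frame_at E x)).
    by apply: openI; [exact: chart_dom_open|exact: frame_dom_open].
  exists (chart_dom c `&` frame_dom (frame_at E x)) => //.
  apply: (@eq_csmooth_fun _ (fun y => ((psi y)%:C * (plane_wave xi \o c) y) *
    coord (frame_at E x y) k (tnth (e y) j))) => //.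
    by move=> z _; rewrite linearZ.
  apply: csmooth_funM => //; first apply: csmooth_funM => //.
  - by apply: csmooth_fun_real => //; exact: smooth_fun_sub spsi.
  - by apply: csmooth_fun_sub (csmooth_fun_plane_wave xi Xc) => z [].
  - by apply: csmooth_fun_sub ((Xe x).1 j k) => z [/ce].
exists (~` closure [set z | psi z != 0]).
  by split; [exact: closed_openC (@closed_closure _ _)|move/psic].
apply: (@eq_csmooth_fun _ (fun=> (0 : R)%:C)).
- exact: closed_openC (@closed_closure _ _).
- move=> z nz; have -> : psi z = 0.
    apply: contra_notP nz => /eqP psiz; exact: subset_closure.
  by rewrite mul0r scale0r linear0.
- apply: csmooth_fun_real; last apply: smooth_fun_cst.
  + exact: closed_openC (@closed_closure _ _).
  + exact: closed_openC (@closed_closure _ _).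
Qed.

End CSmoothFun.

(** * Transport of charts and frames by the group *)

Lemma coord_map_basis (K : fieldType) (U W : vectType K) m (b : m.-tuple U)
    (f : {linear U -> W}) (v : U) k :
  basis_of fullv b -> free (map_tuple f b) -> coord (map_tuple f b) k (f v) = coord b k v.
Proof.
move=> bb ff; rewrite {1}(coord_basis bb (memvf v)) linear_sum.
rewrite -[RHS](coord_sum_free (fun i => coord b i v) k ff).
congr (coord _ k _); apply: eq_bigr => i _; rewrite linearZ.
by congr (_ *: _); rewrite !(nth_map 0) ?size_tuple // .
Qed.

Section Transport.
Context {R : realType} {n : nat} {M : topologicalType} {X : atlas R n M}.
Context {gT : finGroupType} {a : smooth_action X gT}.

Lemma act_continuous g : continuous (a g).
Proof. exact: (act_smooth a g).1. Qed.

Lemma open_act_preimage g (U : set M) : open U -> open (a g @^-1` U).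
Proof. by apply: open_comp => x _; exact: act_continuous. Qed.

Section Chart.
Variables (g : gT) (c : chart R n M).

Let dom : set M := a g^-1%g @^-1` chart_dom c.

Lemma chart_push_image : (c \o a g^-1%g) @` dom = chart_im c.
Proof.
rewrite eqEsubset; split=> _ [x cx <-]; first by exists (a g^-1%g x).
by exists (a g x); rewrite /dom /= act_onK.
Qed.

Lemma chart_push_image_open : open ((c \o a g^-1%g) @` dom).
Proof. by rewrite chart_push_image; exact: chart_im_open. Qed.

Lemma chart_pushK x : dom x -> (a g \o chart_inv c) ((c \o a g^-1%g) x) = x.
Proof. by move=> cx; rewrite /= chart_mapK // act_onKV. Qed.

Lemma chart_push_cont x : dom x -> {for x, continuous (c \o a g^-1%g)}.
Proof.
move=> cx; apply: continuous_comp; first exact: act_continuous.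
exact: chart_map_cont.
Qed.

Lemma chart_push_inv_cont y : ((c \o a g^-1%g) @` dom) y ->
  {for y, continuous (a g \o chart_inv c)}.
Proof.
rewrite chart_push_image => cy; apply: continuous_comp; last exact: act_continuous.
exact: chart_inv_cont.
Qed.

Definition chart_push : chart R n M :=
  Chart (open_act_preimage g^-1%g (chart_dom_open c)) chart_push_image_open chart_pushK
    chart_push_cont chart_push_inv_cont.

End Chart.

(** For a restriction of a preferred chart, the transition maps are restrictions of
the coordinate expressions of g and g^-1. *)
Lemma is_chart_push g x (U : set M) (oU : open U) :
  is_chart X (chart_push g (chart_restr (chart_at X x) oU)).
Proof.
move=> z; split.
  apply: smooth_on_sub ((act_smooth a g).2 x z) => _ [y [[xy _] zy] <-].
  by exists (a g^-1%g y) => //; split => //=; rewrite act_onKV.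
apply: smooth_on_sub ((act_smooth a g^-1%g).2 z x) => _ [y [zy [xy _]] <-].
by exists y.
Qed.

Lemma cutoff_push g c (chi : M -> R) : cutoff (X := X) c chi ->
  cutoff (X := X) (chart_push g c) (chi \o a g^-1%g).
Proof.
move=> [schi chic]; split.
  exact: smooth_fun_comp openT (act_smooth a g^-1%g) schi.
have cl : closed (a g^-1%g @^-1` closure [set x | chi x != 0]).
  by apply: closed_comp; [move=> x _; exact: act_continuous|exact: closed_closure].
suff : closure [set x | (chi \o a g^-1%g) x != 0] `<=`
    a g^-1%g @^-1` closure [set x | chi x != 0] by move=> sub x /sub /chic.
rewrite [X in _ `<=` X](closure_id _).1 //; apply: closure_subset => z chiz.
exact: subset_closure.
Qed.

Section Fibres.
Context {E : bundle X} (A : equivariant a E).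

Lemma eact_id g x (e : a g x = x) v : g = 1%g -> eact A e v = v.
Proof. by move=> g1; subst g; exact: eact1. Qed.

Lemma eactK g h x y (gx : a g x = y) (hy : a h y = x) v :
  (h * g)%g = 1%g -> eact A hy (eact A gx v) = v.
Proof.
move=> hg1; have hgx : a (h * g)%g x = x by rewrite act_onM gx.
by rewrite -(eactM A gx hy hgx); exact: eact_id.
Qed.

Lemma eact_inv g x y (gx : a g x = y) : a g^-1%g y = x.
Proof. by rewrite -gx act_onK. Qed.

Lemma eact_map_basis g x y (gx : a g x = y) m (b : m.-tuple (E x)) :
  basis_of fullv b -> basis_of fullv (map_tuple (eact A gx) b).
Proof.
move=> bb; have kerg : (lker (eact A gx) == 0)%VS.
  apply/lker0P => u v uv; have := congr1 (eact A (eact_inv gx)) uv.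
  by rewrite !eactK // mulVg.
have -> : fullv = (eact A gx @: fullv)%VS.
  apply/eqP; rewrite eqEsubv subvf andbT; apply/subvP => v _.
  rewrite -[v](eactK (eact_inv gx) gx) ?mulgV //; exact: memv_img (memvf _).
by apply: limg_basis_of bb; move/eqP: kerg => ->; rewrite capv0.
Qed.

Lemma coord_eact g x y (gx : a g x = y) m (b : m.-tuple (E x)) v k :
  basis_of fullv b ->
  coord (map_tuple (eact A gx) b) k (eact A gx v) = coord b k v.
Proof.
by move=> bb; apply: coord_map_basis bb (basis_free (eact_map_basis gx bb)).
Qed.

Definition frame_push g (e : frame E) : frame E :=
  @Frame _ _ E (a g^-1%g @^-1` frame_dom e) (frame_rank e)
    (fun y => map_tuple (eact A (act_onKV a g y)) (e (a g^-1%g y)))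
    (open_act_preimage g^-1%g (frame_dom_open e))
    (fun y ey => eact_map_basis (act_onKV a g y) (frame_basis ey)).

(** The fibre over g x carries the image of e x under g: this removes the casts along
g (g^-1 y) = y. *)
Lemma frame_pushE g (e : frame E) x :
  frame_push g e (a g x) = map_tuple (eact A (erefl (a g x))) (e x).
Proof.
rewrite /frame_push /=; move: (act_onKV a g (a g x)); rewrite act_onK => gx.
by rewrite (Prop_irrelevance gx (erefl _)).
Qed.

(** The transition matrices are the coordinate matrices of the actions of g and g^-1 in
the preferred frames. *)
Lemma is_frame_push g x : is_frame (frame_push g (frame_at E x)).
Proof.
move=> z; split=> j k.
  have := csmooth_fun_comp _ (act_smooth a g^-1%g)
    (@eact_smooth _ _ _ _ _ _ _ A g x z j k).
  have oU : open (frame_dom (frame_at E x) `&` a g @^-1` frame_dom (frame_at E z)).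
    by apply: openI; [|apply: open_act_preimage]; exact: frame_dom_open.
  move=> /(_ oU) sm.
  apply: csmooth_fun_sub (_ : csmooth_fun X (a g^-1%g @^-1`
      (frame_dom (frame_at E x) `&` a g @^-1` frame_dom (frame_at E z))) _).
    by move=> y [xy zy]; split => //=; rewrite act_onKV.
  apply: eq_csmooth_fun sm; first exact: open_act_preimage.
  move=> y _ /=; rewrite (tnth_map (eact A (act_onKV a g y))).
  have coordE w y' (e : a g w = y') v :
      coord (frame_at E z (a g w)) k (eact A (erefl (a g w)) v) =
      coord (frame_at E z y') k (eact A e v) by case: y' / e.
  exact: coordE.
have oU : open (frame_dom (frame_at E z) `&` a g^-1%g @^-1` frame_dom (frame_at E x)).
  by apply: openI; [|apply: open_act_preimage]; exact: frame_dom_open.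
apply: eq_csmooth_fun (@eact_smooth _ _ _ _ _ _ _ A g^-1%g z x j k) => // y [zy xy].
rewrite -[in RHS](eactK (erefl (a g^-1%g y)) (act_onKV a g y) (tnth _ j)) ?mulgV //.
by rewrite coord_eact //; exact: frame_basis.
Qed.

End Fibres.
End Transport.

(** * Equivariance of the principal symbol *)

Section SymbolEquivariance.
Context {R : realType} {n : nat} {M : topologicalType} {X : atlas R n M}.
Context {gT : finGroupType} {a : smooth_action X gT} {E F : bundle X}.
Variables (aE : equivariant a E) (aF : equivariant a F).

(** The localized section built from the transported data is g s, for s the one built
from the original data; as P (g s) = g (P s), both sides are the same coordinate of
P s at x. *)
Lemma full_symbol_push (P : operator E F) g c e f chi psi
    (j : 'I_(frame_rank e)) (k : 'I_(frame_rank f)) y xi :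
  invariant_operator aE aF P -> local_data c e f chi psi -> chart_im c y ->
  full_symbol (localization P (e := frame_push aE g e) (f := frame_push aF g f)
    (chart_push (a := a) g c) (chi \o a g^-1%g) (psi \o a g^-1%g) j k) (y, xi) =
  full_symbol (localization P c chi psi j k) (y, xi).
Proof.
move=> invP [Xc [Xe ce] [Xf cf] _ cpsi] [x cx <-]; rewrite /full_symbol; congr (_ * _).
pose s z : E z := ((psi z)%:C * plane_wave xi (c z)) *: tnth (e z) j.
have ss : smooth_section s by exact: smooth_localized_section.
have sE : (fun z : M => ((psi (a g^-1%g z))%:C * plane_wave xi (c (a g^-1%g z))) *:
    tnth (frame_push aE g e z) j) = sact aE g s.
  apply: functional_extensionality_dep => z.
  by rewrite /sact /s linearZ /= (tnth_map (eact aE (act_onKV a g z))).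
rewrite /localization; cbv zeta.
rewrite -[chart_inv (chart_push _ _) _]/(a g (chart_inv c (c x))) chart_mapK //.
rewrite [X in P X _]sE invP // frame_pushE -[(chi \o _) _]/(chi (a g^-1%g (a g x))).
rewrite act_onK; congr (_ * _).
(* The base point g^-1 (g x) has to be replaced by x under the type of the proof. *)
have -> : sact aF g (P s) (a g x) = eact aF (erefl (a g x)) (P s x).
  rewrite /sact; move: (act_onKV a g (a g x)); rewrite act_onK => gx.
  by rewrite (Prop_irrelevance gx (erefl _)).
by rewrite coord_eact //; apply: frame_basis; exact: cf.
Qed.

(** Compare the leading terms of the two readings of P at the point of coordinates
(c x, xi); the cutoff factor, nonzero at x, cancels. *)
Lemma principal_symbol_equivariant (hM : hausdorff_space M) (m : R)
    (P : operator E F) (sigma : symbol_section E F) g x y (gx : a g x = y)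
    (xi : 'rV[R]_n) (v : E x) :
  invariant_operator aE aF P -> principal_symbol m P sigma -> xi != 0 ->
  sigma (y, xi *m (tangent X (a g^-1%g) y)^T) (eact aE gx v) =
  eact aF gx (sigma (x, xi) v).
Proof.
move=> invP Psigma xi0; case: y / gx.
set e := frame_at E x; set f := frame_at F x.
have ex : frame_dom e x by exact: frame_at_mem.
have fx : frame_dom f x by exact: frame_at_mem.
have oU : open (frame_dom e `&` frame_dom f) by apply: openI; exact: frame_dom_open.
(* Local data require the chart to lie in the domains of both frames. *)
pose c := chart_restr (chart_at X x) oU.
have cx : chart_dom c x by split; [exact: chart_at_mem|].
have Xc : is_chart X c by apply: is_chart_restr; exact: is_chart_at.
have [chi [schi chic chix]] := bump_exists (X := X) hM (chart_dom_open c) cx.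
have Xe : is_frame e by move=> z; split; apply: frame_at_compat.
have Xf : is_frame f by move=> z; split; apply: frame_at_compat.
have ld : local_data c e f chi chi.
  by split=> //; split=> // z [_ []].
have ld' : local_data (chart_push (a := a) g c) (frame_push aE g e) (frame_push aF g f)
    (chi \o a g^-1%g) (chi \o a g^-1%g).
  split.
  - exact: is_chart_push.
  - by split; [exact: is_frame_push|move=> z [_ []]].
  - by split; [exact: is_frame_push|move=> z [_ []]].
  - exact: cutoff_push.
  - exact: cutoff_push.
have bf := frame_basis fx; have be := frame_basis ex.
pose xi' := xi *m (tangent X (a g^-1%g) (a g x))^T.
(* The matrix of sigma at g xi in the bases g e, g f is that of sigma at xi in e, f. *)
have key j k : coord (map_tuple (eact aF (erefl (a g x))) (f x)) k
     (sigma (a g x, xi') (eact aE (erefl (a g x)) (tnth (e x) j))) =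
   coord (f x) k (sigma (x, xi) (tnth (e x) j)).
  (* The covector coordinates at x are those of the preferred chart at x, and at g x
     the chart c o g^-1 differs from it by the tangent map of g^-1. *)
  have cov : covector X c x xi = xi.
    have -> : covector X c x xi = xi *m (tangent X id x)^T by [].
    by rewrite tangent_id trmx1 mulmx1.
  have cov' : covector X (chart_push (a := a) g c) (a g x) xi = xi'.
    by rewrite /xi' /tangent act_onK.
  have im : chart_im (chart_push (a := a) g c) = chart_im c by exact: chart_push_image.
  have := Psigma _ _ _ _ _ ld' j k; rewrite im => H'.
  have cim : chart_im c (c x) by exists x.
  have := leading_term_unique
    (fun y eta cy => full_symbol_push g j k eta invP ld cy)
    H' (Psigma _ _ _ _ _ ld j k) cim xi0.
  cbv zeta; rewrite [(c x, xi).1]/= [(c x, xi).2]/=.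
  rewrite -[chart_inv (chart_push _ _) _]/(a g (chart_inv c (c x))).
  rewrite (chart_mapK cx).
  rewrite cov cov' !frame_pushE.
  rewrite -[(chi \o _) _]/(chi (a g^-1%g (a g x))).
  rewrite act_onK (tnth_map (eact aE (erefl (a g x)))); apply: mulfI.
  by rewrite eq_complex /= eqxx andbT mulf_neq0.
have bgf := eact_map_basis aF (erefl (a g x)) bf.
rewrite -/xi' [in LHS](coord_basis be (memvf v)) [in RHS](coord_basis be (memvf v)).
rewrite !linear_sum /=; apply: eq_bigr => j _; rewrite !linearZ /=; congr (_ *: _).
rewrite -tnth_nth [LHS](coord_basis bgf (memvf _)) [RHS](coord_basis bgf (memvf _)).
by apply: eq_bigr => k _; rewrite key coord_eact.
Qed.

End SymbolEquivariance.

(** * Isotypical components of the fibres *)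

Section Matrices.
Context {K : fieldType}.
Implicit Types U V W : vectType K.

Definition col_of_vec U (u : U) : 'cV[K]_(dim U) := (v2r u)^T.
Definition vec_of_col U (w : 'cV[K]_(dim U)) : U := r2v w^T.
Definition lfun_mx U V (f : 'Hom(U, V)) : 'M[K]_(dim V, dim U) :=
  (lin1_mx (v2r \o f \o r2v))^T.

Lemma col_of_vecK U : cancel (@col_of_vec U) (@vec_of_col U).
Proof. by move=> u; rewrite /vec_of_col trmxK v2rK. Qed.

Lemma vec_of_colK U : cancel (@vec_of_col U) (@col_of_vec U).
Proof. by move=> u; rewrite /col_of_vec r2vK trmxK. Qed.

Lemma lfun_mxE U V (f : 'Hom(U, V)) u : lfun_mx f *m col_of_vec u = col_of_vec (f u).
Proof. by rewrite -trmx_mul mul_rV_lin1 /= v2rK. Qed.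

Lemma eq_mul_col_of_vec U m (A B : 'M[K]_(m, dim U)) :
  (forall u, A *m col_of_vec u = B *m col_of_vec u) -> A = B.
Proof.
move=> AB; apply/trmx_inj/row_matrixP => i.
have := congr1 trmx (AB (vec_of_col (delta_mx i 0))).
by rewrite vec_of_colK -!colE !tr_col.
Qed.

Definition mx_lfun d U (T : 'M[K]_(dim U, d)) : 'Hom('cV[K]_d, U) :=
  linfun (fun w => vec_of_col (T *m w)).

Lemma mx_lfunE d U (T : 'M[K]_(dim U, d)) w : mx_lfun T w = vec_of_col (T *m w).
Proof.
have lin : linear (fun w : 'cV[K]_d => vec_of_col (T *m w)).
  by move=> k u v; rewrite /vec_of_col mulmxDr -scalemxAr linearP linearP.
pose L := GRing.isLinear.Build _ _ _ _ (fun w : 'cV[K]_d => vec_of_col (T *m w)) lin.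
pose f : {linear 'cV[K]_d -> U} := HB.pack (fun w : 'cV[K]_d => vec_of_col (T *m w)) L.
exact: (lfunE f w).
Qed.

End Matrices.

Section FibreRepresentation.
Context {R : realType} {n : nat} {M : topologicalType} {X : atlas R n M}.
Context {gT : finGroupType} {a : smooth_action X gT} {E : bundle X}.
Variables (A : equivariant a E) (p : cotangent R n M).

Lemma cstab_fix h : h \in cstab a p -> a h p.1 = p.1.
Proof. by rewrite inE => /eqP hp; rewrite -[in RHS]hp. Qed.

(** [eact] expects a proof that h fixes the base point; the default value 1 turns the
matrix of h on the fibre into a total function of h, as [mx_repr] requires. *)
Definition fibre_mx (h : gT) : 'M[R[i]]_(dim (E p.1)) :=
  if pselect (a h p.1 = p.1) is left e then lfun_mx (eact A e) else 1%:M.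

Lemma fibre_mxE h (e : a h p.1 = p.1) u :
  fibre_mx h *m col_of_vec u = col_of_vec (eact A e u).
Proof.
rewrite /fibre_mx; case: pselect => // e'.
by rewrite lfun_mxE (Prop_irrelevance e' e).
Qed.

Lemma fibre_mx_repr : mx_repr (cstab a p) fibre_mx.
Proof.
split=> [|g h gp hp]; apply: eq_mul_col_of_vec => u.
  by rewrite mul1mx (fibre_mxE (act_on1 a _)) eact1.
have [eg eh] := (cstab_fix gp, cstab_fix hp).
have egh := cstab_fix (groupM gp hp).
by rewrite -mulmxA (fibre_mxE egh) (fibre_mxE eh) (fibre_mxE eg) (eactM A eh eg egh).
Qed.

Definition fibre_repr := MxRepresentation fibre_mx_repr.

Lemma intertwiner_isotypical d (rho : mx_representation R[i] (cstab a p) d)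
    (T : 'Hom('cV[R[i]]_d, E p.1)) w :
  intertwiner A rho T -> isotypical A rho (T w).
Proof.
by move=> rhoT; exists 1%N, (fun=> T), (fun=> w); split => //; rewrite big_ord1.
Qed.

Lemma isotypical0 d (rho : mx_representation R[i] (cstab a p) d) :
  isotypical A rho 0.
Proof.
exists 0%N, (fun=> 0), (fun=> 0); split; first by case.
by rewrite big_ord0.
Qed.

Lemma mx_lfun_intertwiner d (rho : mx_representation R[i] (cstab a p) d)
    (T : 'M[R[i]]_(dim (E p.1), d)) :
  (forall h, h \in cstab a p -> fibre_repr h *m T = T *m rho h) ->
  intertwiner A rho (mx_lfun T).
Proof.
move=> cT h hx hp v; apply: (can_inj (@col_of_vecK _ _)).
by rewrite -fibre_mxE !mx_lfunE !vec_of_colK !mulmxA -cT.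
Qed.

End FibreRepresentation.

Section IsotypicalBijection.
Context {R : realType} {n : nat} {M : topologicalType} {X : atlas R n M}.
Context {gT : finGroupType} {a : smooth_action X gT} {E F : bundle X}.
Variables (aE : equivariant a E) (aF : equivariant a F) (p : cotangent R n M).
Variable f : 'Hom(E p.1, F p.1).
Hypothesis cf : forall h (hx : a h p.1 = p.1), h \in cstab a p ->
  forall v, f (eact aE hx v) = eact aF hx (f v).

(** Matrix intertwiners produced by [equivariant_inverse_exists] are turned into
intertwiners with values in the fibres, whose images lie in isotypical
components. *)
Lemma bijective_of_isotypical :
  (forall d (rho : mx_representation R[i] (cstab a p) d), mx_irreducible rho ->
     set_bij (isotypical aE rho) (isotypical aF rho) f) -> bijective f.
Proof.
move=> bf; have [||| S' [S'S SS']] := equivariant_inverse_exists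
    (A1 := fibre_repr aE p) (A2 := fibre_repr aF p) (S := lfun_mx f).
- move=> h hp; have e := cstab_fix hp; apply: eq_mul_col_of_vec => u.
  by rewrite -!mulmxA !(fibre_mxE _ e) !lfun_mxE (fibre_mxE _ e) cf.
- move=> d rho T w irr cT; have [_ inj _] := bf _ rho irr.
  have iT := mx_lfun_intertwiner cT.
  rewrite -[T *m w](@vec_of_colK _ (E p.1)) -mx_lfunE lfun_mxE => Sw0.
  have fw0 : f (mx_lfun T w) = 0.
    by apply: (can_inj (@col_of_vecK _ _)); rewrite Sw0 /col_of_vec linear0 trmx0.
  rewrite (inj (mx_lfun T w) 0) ?inE ?linear0 //.
  + by rewrite /col_of_vec linear0 trmx0.
  + exact: intertwiner_isotypical.
  + exact: isotypical0.
- move=> d rho T w irr cT; have [_ _ surj] := bf _ rho irr.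
  have iT := mx_lfun_intertwiner cT.
  have [u _ fu] := surj _ (intertwiner_isotypical w iT).
  by exists (col_of_vec u); rewrite lfun_mxE fu mx_lfunE vec_of_colK.
exists (fun w => vec_of_col (S' *m col_of_vec w)) => u.
  by rewrite -lfun_mxE mulmxA S'S mul1mx col_of_vecK.
by apply: (can_inj (@col_of_vecK _ _)); rewrite -lfun_mxE vec_of_colK mulmxA SS' mul1mx.
Qed.

(** Composition with f and with its inverse exchanges the intertwiners from rho into
the two fibres. *)
Lemma isotypical_of_bijective d (rho : mx_representation R[i] (cstab a p) d) :
  bijective f -> set_bij (isotypical aE rho) (isotypical aF rho) f.
Proof.
move=> bf; have kerf : lker f == 0%VS by apply/lker0P; exact: bij_inj.
have fK w : f ((f^-1)%VF w) = w.
  by have [g _ gK] := bf; apply: limg_lfunVK; rewrite -(gK w) memv_img ?memvf.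
split.
- move=> _ [k [T [w [iT ->]]]]; exists k, (fun i => f \o T i)%VF, w; split.
    by move=> i h hx hp v; rewrite !comp_lfunE (iT i h hx hp) cf.
  by rewrite linear_sum; apply: eq_bigr => i _; rewrite comp_lfunE.
- by move=> u v _ _; exact: bij_inj.
- move=> _ [k [T [w [iT ->]]]].
  exists (\sum_i (f^-1 \o T i)%VF (w i)); last first.
    by rewrite linear_sum; apply: eq_bigr => i _; rewrite comp_lfunE /= fK.
  exists k, (fun i => f^-1 \o T i)%VF, w; split => // i h hx hp v.
  by apply: (bij_inj bf); rewrite cf // !comp_lfunE !fK (iT i h hx hp).
Qed.

End IsotypicalBijection.

(** * Trivial minimal isotropy *)

Section TrivialIsotropy.
Context {R : realType} {n : nat} {M : topologicalType} {X : atlas R n M}.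
Context {gT : finGroupType} {a : smooth_action X gT}.

(** The isotropy group of a point with free orbit is trivial, hence contained in
Gamma_0, hence equal to it. *)
Lemma minimal_isotropy_trivial (G0 : {group gT}) h :
  free_on_dense a -> minimal_isotropy a G0 -> h \in G0 -> h = 1%g.
Proof.
move=> [D [dD freeD]] [[x ->] minx]; have [y [_ Dy]] := dD setT (ex_intro _ x I) openT.
have sy g : g \in stab a y -> g = 1%g by rewrite inE => /eqP; exact: freeD.
rewrite -(minx y); first exact: sy.
by apply/fintype.subsetP => g /sy ->; exact: group1.
Qed.

(** With Gamma_0 = 1, any nonzero matrix B, such as the constant one, is an element of
Hom_(Gamma_0)(rho, alpha). *)
Lemma in_X_of_trivial (G0 : {group gT}) da
    (alpha : mx_representation R[i] [set: gT]%G da)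
    (p : cotangent R n M) d (rho : mx_representation R[i] (cstab a p) d) :
  (forall h, h \in G0 -> h = 1%g) -> mx_irreducible alpha -> mx_irreducible rho ->
  p.2 != 0 -> in_X G0 alpha rho.
Proof.
move=> G1 /mx_irrP[da0 _] /mx_irrP[d0 _] p0; split => //; exists 1%g; split.
  by apply/fintype.subsetP => h /G1 ->; exact: group1.
exists (const_mx 1); split.
  apply/eqP => /matrixP/(_ (Ordinal da0) (Ordinal d0))/eqP.
  by rewrite !mxE oner_eq0.
by move=> h /G1 ->; rewrite conj1g !repr_mx1 mulmx1 mul1mx.
Qed.

End TrivialIsotropy.

Theorem proposition4p16 (R : realType) (n : nat) (M : topologicalType)
  (hM : hausdorff_space M) (cM : compact [set: M]) (X : atlas R n M)
  (G : riemannian_metric X)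
  (gT : finGroupType) (a : smooth_action X gT)
  (isoa : forall g : gT, riemannian_isometry G (a g))
  (connMG : connected [set: orbit_space a])
  (E F : bundle X) (aE : equivariant a E) (aF : equivariant a F)
  (freea : free_on_dense a)
  (m : R) (P : operator E F) (psiP : pseudodifferential m P)
  (invP : invariant_operator aE aF P)
  (sigma : symbol_section E F) (sigmaP : principal_symbol m P sigma)
  (G0 : {group gT}) (minG0 : minimal_isotropy a G0)
  (da : nat) (alpha : mx_representation R[i] [set: gT]%G da)
  (irr_alpha : mx_irreducible alpha) :
  alpha_elliptic aE aF G0 alpha sigma <-> elliptic sigma.
Proof.
have csigma p : p.2 != 0 -> forall h (hx : a h p.1 = p.1), h \in cstab a p ->
    forall v, sigma p (eact aE hx v) = eact aF hx (sigma p v).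
  case: p => x xi /= xi0 h hx; rewrite inE => /eqP[_ hxi] v.
  by rewrite -(principal_symbol_equivariant hM hx v invP sigmaP xi0) -[in LHS]hxi hx.
have G1 h : h \in G0 -> h = 1%g by exact: minimal_isotropy_trivial minG0.
split=> [ell p p0|ell p d rho irr [p0 _]]; last first.
  by apply: isotypical_of_bijective (ell p p0) => h hx hp; exact: csigma.
apply: (bijective_of_isotypical (csigma p p0)) => d rho irr.
by apply: ell => //; exact: in_X_of_trivial.
Qed.
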